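(* Suppose Assumption A holds and Assumption B holds with $p=3$. Define $M_3=4\big(f(x^0)-f_{\mathrm{low}}+19\sigma^2+L_1+4L_3^2+2\big)$. Let $\{x^k\}_{k\ge0}$ be generated by Algorithm 1 with $q=2$ and, for all $k\ge0$, \[ \eta_k=\frac{1}{(k+3)^{7/10}},\quad \gamma_{k,1}=\frac{1}{(k+3)^{3/5}},\quad \gamma_{k,2}=\frac{1}{2(k+3)^{3/5}},\quad \theta_{k,1}=\frac{2(k+3)^{3/5}-1}{(k+3)^{6/5}},\quad \theta_{k,2}=\frac{1-(k+3)^{3/5}}{2(k+3)^{6/5}}. \] For $K\ge1$ let $\iota_K$ be drawn uniformly from $\{0,\dots,K-1\}$, independently of the algorithm. Then for every $\epsilon\in(0,1)$, \[ \mathbb{E}[\|\nabla f(x^{\iota_K})\|]\le\epsilon\qquad\text{for all } K\ge\max\Big\{\Big(\frac{20M_3}{3\epsilon}\ln\Big(\frac{20M_3}{3\epsilon}\Big)\Big)^{10/3},\,5\Big\}, \] where the expectation is over the randomness of the algorithm and of $\iota_K$.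
   Context: Problem: minimize $f:\mathbb{R}^n\to\mathbb{R}$, where only a stochastic gradient estimator $G(\cdot;\xi)$ is accessible, $\xi$ being a random variable with sample space $\Xi$. $\|\cdot\|$ is the Euclidean norm. Assumption A: (a) there is a finite $f_{\mathrm{low}}$ with $f(x)\ge f_{\mathrm{low}}$ for all $x$; (b) there is $L_1>0$ with $\|\nabla f(y)-\nabla f(x)\|\le L_1\|y-x\|$ for all $x,y$; (c) $\mathbb{E}_\xi[G(x;\xi)]=\nabla f(x)$ and $\mathbb{E}_\xi[\|G(x;\xi)-\nabla f(x)\|^2]\le\sigma^2$ for all $x$, for some $\sigma>0$. Assumption B: $f$ is $p$ times continuously differentiable for some $p\ge2$ and there is $L_p>0$ with $\|D^pf(y)-D^pf(x)\|_{(p)}\le L_p\|y-x\|$ for all $x,y$, where $D^pf(x)$ is the $p$th derivative as a symmetric $p$-linear form and $\|\mathcal{T}\|_{(p)}=\max\{\mathcal{T}[h_1,\dots,h_p]:\|h_i\|\le 1\}$. Algorithm 1 (SFOM with multi-extrapolated momentum): inputs $x^0\in\mathbb{R}^n$, step sizes $\eta_k>0$, an integer $q\ge1$, extrapolation parameters $\gamma_{k,t}\in(0,1)$ and weighting parameters $\theta_{k,t}\in\mathbb{R}$ ($1\le t\le q$, $k\ge0$) with $\sum_{t=1}^q\theta_{k,t}\in(0,1)$ for all $k\ge0$. Initialize $x^{-1}=x^0$, $m^{-1}=0$, $(\gamma_{-1,t},\theta_{-1,t})=(1,1/q)$ for all $t$. For $k=0,1,2,\dots$: $z^{k,t}=x^k+\frac{1-\gamma_{k-1,t}}{\gamma_{k-1,t}}(x^k-x^{k-1})$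 for $1\le t\le q$; $m^k=(1-\sum_{t=1}^q\theta_{k-1,t})m^{k-1}+\sum_{t=1}^q\theta_{k-1,t}G(z^{k,t};\xi^k)$; $x^{k+1}=x^k-\eta_k m^k/\|m^k\|$. Here $\xi^0,\xi^1,\dots$ are independent samples of $\xi$ (and $m^k\neq0$ is implicitly assumed). *)

(* Defs.v *)
From mathcomp Require Import all_boot all_order all_algebra.
From mathcomp Require Import all_classical all_reals all_analysis.
Import Order.TTheory GRing.Theory Num.Theory.
Import numFieldNormedType.Exports.

Set Implicit Arguments.
Unset Strict Implicit.
Unset Printing Implicit Defensive.

Local Open Scope classical_set_scope.
Local Open Scope ring_scope.

Section Defs.
Variable R : realType.
Variable n : nat.

Definition enorm (v : 'rV[R]_n) : R := Num.sqrt (\sum_(i < n) (v ord0 i) ^+ 2).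

Definition ebasis (i : 'I_n) : 'rV[R]_n := delta_mx ord0 i.

Definition grad (f : 'rV[R]_n -> R) (x : 'rV[R]_n) : 'rV[R]_n :=
  \row_(i < n) ('d f x (ebasis i)).

Definition D1 (f : 'rV[R]_n -> R) (x h1 : 'rV[R]_n) : R := 'd f x h1.
Definition D2 (f : 'rV[R]_n -> R) (x h1 h2 : 'rV[R]_n) : R :=
  'd (fun y => D1 f y h1) x h2.
Definition D3 (f : 'rV[R]_n -> R) (x h1 h2 h3 : 'rV[R]_n) : R :=
  'd (fun y => D2 f y h1 h2) x h3.

(* f is three times continuously differentiable (finite dimension: the
   derivative maps are differentiable/continuous iff each of their
   evaluations at fixed directions is) *)
Definition C3 (f : 'rV[R]_n -> R) : Prop :=
  [/\ forall x, differentiable f x,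
      forall h1 x, differentiable (fun y => D1 f y h1) x,
      forall h1 h2 x, differentiable (fun y => D2 f y h1 h2) x &
      forall h1 h2 h3, continuous (fun y => D3 f y h1 h2 h3)].

(* Assumption B with p = 3: ||D^3 f(y) - D^3 f(x)||_(3) <= L3 ||y - x||,
   the operator norm being the max over unit directions *)
Definition third_deriv_lipschitz (f : 'rV[R]_n -> R) (L3 : R) : Prop :=
  forall x y h1 h2 h3, enorm h1 <= 1 -> enorm h2 <= 1 -> enorm h3 <= 1 ->
    D3 f y h1 h2 h3 - D3 f x h1 h2 h3 <= L3 * enorm (y - x).

Section Prob.
Context {d : measure_display} {Omega : measurableType d}.
Context {dX : measure_display} {Xi : measurableType dX}.
Variable P : probability Omega R.

Definition mutually_independent (xi : nat -> Omega -> Xi) : Prop :=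
  forall (s : seq nat), uniq s ->
  forall A : nat -> set Xi, (forall i, measurable (A i)) ->
    P (\bigcap_(i in [set` s]) (xi i @^-1` A i)) =
    (\prod_(i <- s) P (xi i @^-1` A i))%E.

(* Algorithm 1.  The state at step k is (x^k, x^{k-1}, m^{k-1}). *)
Variables (q : nat) (x0 : 'rV[R]_n) (eta : nat -> R)
  (gam theta : nat -> 'I_q -> R) (G : 'rV[R]_n -> Xi -> 'rV[R]_n)
  (xi : nat -> Omega -> Xi).

(* gamma_{k-1,t}, theta_{k-1,t}, with (gamma_{-1,t},theta_{-1,t}) = (1,1/q) *)
Definition gam_prev (k : nat) (t : 'I_q) : R :=
  if k is k'.+1 then gam k' t else 1.
Definition theta_prev (k : nat) (t : 'I_q) : R :=
  if k is k'.+1 then theta k' t else q%:R^-1.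

Definition alg1_step (k : nat) (w : Omega)
  (st : 'rV[R]_n * 'rV[R]_n * 'rV[R]_n) : 'rV[R]_n * 'rV[R]_n * 'rV[R]_n :=
  let: (xk, xkm1, mkm1) := st in
  let z := fun t : 'I_q =>
     xk + ((1 - gam_prev k t) / gam_prev k t) *: (xk - xkm1) in
  let mk := (1 - \sum_(t < q) theta_prev k t) *: mkm1
            + \sum_(t < q) theta_prev k t *: G (z t) (xi k w) in
  (xk - (eta k / enorm mk) *: mk, xk, mk).

Fixpoint alg1_state (k : nat) (w : Omega) : 'rV[R]_n * 'rV[R]_n * 'rV[R]_n :=
  if k is k'.+1 then alg1_step k' w (alg1_state k' w) else (x0, x0, 0).

Definition alg1_x (k : nat) (w : Omega) : 'rV[R]_n := (alg1_state k w).1.1.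
Definition alg1_m (k : nat) (w : Omega) : 'rV[R]_n := (alg1_state k.+1 w).2.

End Prob.
End Defs.

(* Main.v *)
(** Write e_k = m^k - grad f(x^k), r_k = (k+3)^(1/10) and v_k = E |e_k|^2.
    Since |x^{k+1} - x^k| = eta_k, the weights satisfy
    sum_t theta_t / gamma_t = sum_t theta_t / gamma_t^2 = 1 exactly so that the
    first and second order Taylor terms of the drift of e_k cancel; the drift is
    then at most L3 r_k^-9, and independence of xi^{k+1} from the past gives
      v_{k+1} <= (1 - r_k^-6) v_k + (L3^2 + 17/2 sigma^2) r_k^-12.
    A normalized step decreases f by eta_k |grad f(x^k)| up to 2 eta_k |e_k| and
    a quadratic term.  Weighting v_k by r_k^2 = (k+3)^(1/5) and summing bounds
    sum_k eta_k E |grad f(x^k)| by (M_3 / 4) ln K; dividing by K eta_K and using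
    ln y <= 2 y / T whenever y >= T ln T gives the stated complexity. *)

(* Each displacement is eta_k times a unit vector and extrapolation only rescales it, so x^k,
   x^{k+1} and both z^{k+1,t} lie on one line and one-dimensional Taylor expansion suffices. The
   powers balance as follows: the squared drift, of order r^-18, is divided by theta_1 + theta_2 >=
   r^-6, which gives r^-12, the order of the noise; the weight r^2 turns this into r^-10 = 1/(k+3),
   whose sum is logarithmic. Both estimates of a step share one sample, so their noises are
   correlated; |theta_1| <= 2 r^-6, |theta_2| <= r^-6 / 2 and |u + v|^2 <= 2 |u|^2 + 2 |v|^2 give
   the constant 8 + 1/2 = 17/2. The obstacle is probabilistic: independence is given for finite
   families of samples, while the recursion conditions on the whole past. It is overcome by showing
   that the law of (state, next sample) is a product measure. Objective values are never integrated:
   the descent inequality telescopes pathwise, and f(x^K) >= f_low is used before taking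
   expectations. *)
Require Import Defs.
From HB Require Import structures.
From mathcomp Require Import all_boot all_order all_algebra.
From mathcomp Require Import all_classical all_reals all_analysis.
From mathcomp Require Import measurable_realfun ring lra.
Import Order.TTheory GRing.Theory Num.Theory.
Import numFieldNormedType.Exports.
Local Open Scope classical_set_scope.
Local Open Scope ring_scope.

Set Implicit Arguments.
Unset Strict Implicit.
Unset Printing Implicit Defensive.

(** * Euclidean norm and Taylor expansion along lines *)

Section Euclid.
Context {R : realType} {n : nat}.
Implicit Types u v w e r : 'rV[R]_n.

Definition dot u v : R := \sum_(i < n) u ord0 i * v ord0 i.

Lemma dotC u v : dot u v = dot v u.
Proof. by apply: eq_bigr => i _; rewrite mulrC. Qed.

Lemma dotDl u v w : dot (u + v) w = dot u w + dot v w.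
Proof. by rewrite -big_split; apply: eq_bigr => i _; rewrite mxE mulrDl. Qed.

Lemma dotZl a u v : dot (a *: u) v = a * dot u v.
Proof. by rewrite mulr_sumr; apply: eq_bigr => i _; rewrite mxE mulrA. Qed.

Lemma dotNl u v : dot (- u) v = - dot u v.
Proof. by rewrite -scaleN1r dotZl mulN1r. Qed.

Lemma dotDr u v w : dot w (u + v) = dot w u + dot w v.
Proof. by rewrite dotC dotDl !(dotC w). Qed.

Lemma dotZr a u v : dot u (a *: v) = a * dot u v.
Proof. by rewrite dotC dotZl (dotC u). Qed.

Lemma dotNr u v : dot u (- v) = - dot u v.
Proof. by rewrite dotC dotNl (dotC u). Qed.

Lemma dot_ge0 u : 0 <= dot u u.
Proof. by apply: sumr_ge0 => i _; rewrite -expr2 sqr_ge0. Qed.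

Lemma enorm_ge0 u : 0 <= enorm u.
Proof. exact: sqrtr_ge0. Qed.

Lemma sqr_enorm u : enorm u ^+ 2 = dot u u.
Proof.
rewrite sqr_sqrtr; first by apply: eq_bigr => i _; rewrite expr2.
by apply: sumr_ge0 => i _; rewrite sqr_ge0.
Qed.

Lemma enorm0 : enorm (0 : 'rV[R]_n) = 0.
Proof.
by apply/eqP; rewrite -sqrf_eq0 sqr_enorm -(scale0r 0) dotZl mul0r.
Qed.

Lemma enorm_eq0 u : (enorm u == 0) = (u == 0).
Proof.
apply/idP/eqP => [|->]; last by rewrite enorm0.
rewrite -sqrf_eq0 sqr_enorm psumr_eq0 => [/allP h|i _]; last first.
  by rewrite -expr2 sqr_ge0.
apply/rowP => i; rewrite mxE; apply/eqP.
by rewrite -sqrf_eq0 expr2; apply: h; rewrite mem_index_enum.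
Qed.

Lemma enorm_gt0 u : u != 0 -> 0 < enorm u.
Proof. by move=> u0; rewrite lt_neqAle eq_sym enorm_eq0 u0 enorm_ge0. Qed.

Lemma enormZ a u : enorm (a *: u) = `|a| * enorm u.
Proof.
apply/eqP; rewrite -(@eqrXn2 _ 2)// ?mulr_ge0 ?enorm_ge0//.
by rewrite exprMn !sqr_enorm dotZl dotZr real_normK ?num_real// expr2 mulrA.
Qed.

Lemma enormN u : enorm (- u) = enorm u.
Proof. by rewrite -scaleN1r enormZ normrN1 mul1r. Qed.

Lemma dot_le_enorm u v : dot u v <= enorm u * enorm v.
Proof.
have [->|u0] := eqVneq u 0; first by rewrite enorm0 -(scale0r 0) dotZl !mul0r.
have [->|v0] := eqVneq v 0.
  by rewrite enorm0 -(scale0r 0) dotZr mul0r mulr0.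
have := dot_ge0 (enorm v *: u - enorm u *: v).
rewrite dotDl !dotDr !dotNl !dotNr !dotZl !dotZr -!sqr_enorm (dotC v u).
move: (enorm_gt0 u0) (enorm_gt0 v0); set a := enorm u; set b := enorm v.
move=> a0 b0 h; rewrite -(@ler_pM2l _ (a * b)) ?mulr_gt0//; nra.
Qed.

Lemma enormD_le u v : enorm (u + v) <= enorm u + enorm v.
Proof.
rewrite -(@ler_pXn2r _ 2) ?nnegrE ?addr_ge0 ?enorm_ge0//.
rewrite sqrrD !sqr_enorm dotDl !dotDr (dotC v u).
by have := dot_le_enorm u v; lra.
Qed.

(** Convexity of the square in each coordinate, applied to (1 - t) e + t (r / t). Unlike a Young
    inequality with a free parameter, it keeps the contraction factor 1 - t intact. *)
Lemma sqr_enorm_convex (t : R) e r : 0 < t <= 1 ->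
  enorm ((1 - t) *: e + r) ^+ 2 <= (1 - t) * enorm e ^+ 2 + enorm r ^+ 2 / t.
Proof.
move=> /andP[t0 t1]; rewrite !sqr_enorm mulr_sumr mulr_suml -big_split.
apply: ler_sum => i _; rewrite !mxE; set a := e _ _; set b := r _ _.
have {1 2}-> : b = t * (b / t) by rewrite mulrCA mulfV ?mulr1// gt_eqF.
have -> : b * b / t = t * (b / t) ^+ 2 by field; rewrite gt_eqF.
rewrite -subr_ge0; set c := b / t.
have -> : (1 - t) * (a * a) + t * c ^+ 2 -
   ((1 - t) * a + t * c) * ((1 - t) * a + t * c)
  = t * (1 - t) * (a - c) ^+ 2 by ring.
by apply: mulr_ge0; [apply: mulr_ge0; lra|exact: sqr_ge0].
Qed.

Lemma sqr_enormD_le u v :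
  enorm (u + v) ^+ 2 <= 2 * enorm u ^+ 2 + 2 * enorm v ^+ 2.
Proof.
rewrite !sqr_enorm; have := dot_ge0 (u - v).
by rewrite !dotDl !dotDr !dotNl !dotNr (dotC v u); lra.
Qed.

(** Duality: reduces a bound on a vector remainder to scalar Taylor bounds, one unit direction at a
    time. *)
Lemma enorm_le_dot u (B : R) : 0 <= B ->
  (forall v, enorm v = 1 -> dot u v <= B) -> enorm u <= B.
Proof.
move=> B0 h; have [->|u0] := eqVneq u 0; first by rewrite enorm0.
have p := enorm_gt0 u0.
have := h ((enorm u)^-1 *: u); rewrite enormZ dotZr -sqr_enorm.
rewrite ger0_norm ?invr_ge0 ?enorm_ge0// mulVf ?gt_eqF// expr2 mulKf ?gt_eqF//.
by apply.
Qed.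

End Euclid.

(** * Derivatives along lines and Taylor bounds for real functions *)

Section Calculus.
Context {R : realType}.

Lemma is_derive_line {n} (F F' : 'rV[R]_n -> R) (x v : 'rV[R]_n) (t : R) :
  (forall y, differentiable F y) -> (forall y, 'd F y v = F' y) ->
  is_derive t (1 : R) (fun s : R => F (x + s *: v)) (F' (x + t *: v)).
Proof.
move=> dF F'E; rewrite -F'E.
have E : (fun h : R => h^-1 *: (F (x + (h *: 1 + t) *: v) - F (x + t *: v))) =
   (fun h => h^-1 *: (F (h *: v + (x + t *: v)) - F (x + t *: v))).
  apply: funext => h; congr (_ *: (F _ - _)).
  by rewrite scalerDl [h *: 1]mulr1 addrCA.
have D := @diff_derivable _ _ _ F (x + t *: v) v (dF _).
split; first by rewrite /derivable /= E.
by rewrite -deriveE// /derive /= E.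
Qed.

Lemma derive_le0_le (g g' : R -> R) :
  (forall t : R, is_derive t (1 : R) g (g' t)) ->
  (forall t, 0 <= t -> g' t <= 0) ->
  forall t, 0 <= t -> g t <= g 0.
Proof.
move=> dg g'0 t t0.
apply: (@ler0_derive1_nincr _ g 0 t) => //.
- move=> x; rewrite in_itv/= => /andP[x0 _].
  by rewrite derive1E derive_val g'0// ltW.
- apply: continuous_subspaceT => x.
  by apply: differentiable_continuous; exact/derivable1_diffP.
Qed.

Lemma taylor1_le (g g' : R -> R) (L : R) :
  (forall t : R, is_derive t (1 : R) g (g' t)) ->
  (forall t, 0 <= t -> g' t - g' 0 <= L * t) ->
  forall t, 0 <= t -> g t <= g 0 + t * g' 0 + L * t ^+ 2 / 2.
Proof.
move=> dg hL t t0.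
pose h := fun s => g s - (g' 0 * s + L / 2 * s ^+ 2).
have dh s : is_derive s (1 : R) h (g' s - (g' 0 + L * s)).
  apply: is_derive_eq.
  by rewrite /GRing.scale/= !mulr1; field.
have : h t <= h 0.
  apply: (derive_le0_le dh) => // s s0.
  by have := hL s s0; lra.
by rewrite /h !expr2 !mulr0; lra.
Qed.

(** The defect between [g] and its cubic majorant has a nonpositive derivative, by [taylor1_le]
    applied to [g']. *)
Lemma taylor2_le (g g' g'' : R -> R) (L : R) :
  (forall t : R, is_derive t (1 : R) g (g' t)) ->
  (forall t : R, is_derive t (1 : R) g' (g'' t)) ->
  (forall t, 0 <= t -> g'' t - g'' 0 <= L * t) ->
  forall t, 0 <= t ->
  g t <= g 0 + t * g' 0 + t ^+ 2 / 2 * g'' 0 + L * t ^+ 3 / 6.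
Proof.
move=> dg dg' hL t t0.
pose h := fun s => g s - (g' 0 * s + g'' 0 / 2 * s ^+ 2 + L / 6 * s ^+ 3).
have dh s : is_derive s (1 : R) h (g' s - (g' 0 + g'' 0 * s + L / 2 * s ^+ 2)).
  apply: is_derive_eq.
  by rewrite /GRing.scale/= !mulr1; field.
have : h t <= h 0.
  apply: (derive_le0_le dh) => // s s0.
  by have := taylor1_le dg' hL s0; lra.
by rewrite /h !exprS !mul0r !mulr0; lra.
Qed.

Lemma taylor2_norm (g g' g'' : R -> R) (L : R) :
  (forall t : R, is_derive t (1 : R) g (g' t)) ->
  (forall t : R, is_derive t (1 : R) g' (g'' t)) ->
  (forall t, 0 <= t -> `|g'' t - g'' 0| <= L * t) ->
  forall t, 0 <= t ->
  `|g t - (g 0 + t * g' 0 + t ^+ 2 / 2 * g'' 0)| <= L * t ^+ 3 / 6.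
Proof.
move=> dg dg' hL t t0.
have d1 s : is_derive s (1 : R) (- g) ((- g') s) by exact: is_deriveN.
have d2 s : is_derive s (1 : R) (- g') ((- g'') s) by exact: is_deriveN.
have hN s : 0 <= s -> (- g'') s - (- g'') 0 <= L * s.
  by move=> s0; rewrite !fctE; have := hL s s0; rewrite ler_norml; lra.
have h s : 0 <= s -> g'' s - g'' 0 <= L * s.
  by move=> s0; have := hL s s0; rewrite ler_norml; lra.
have := taylor2_le d1 d2 hN t0; have := taylor2_le dg dg' h t0.
by rewrite !fctE ler_norml => h1 h2; apply/andP; split; lra.
Qed.

End Calculus.

(** * Descent inequality and expansion of the gradient along a line *)

Section Objective.
Context {R : realType} {n : nat} (f : 'rV[R]_n -> R).
Hypothesis f_C3 : C3 f.

Lemma dot_grad x v : 'd f x v = dot (grad f x) v.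
Proof.
rewrite {1}(row_sum_delta v) linear_sum; apply: eq_bigr => i _.
by rewrite linearZ /= mxE mulrC.
Qed.

Lemma descent L1 x v t : 
  (forall y z, enorm (grad f z - grad f y) <= L1 * enorm (z - y)) ->
  enorm v = 1 -> 0 <= t ->
  f (x + t *: v) <= f x + t * dot (grad f x) v + L1 * t ^+ 2 / 2.
Proof.
move=> hL v1 t0; have [df _ _ _] := f_C3.
have D s := is_derive_line x s df (dot_grad^~ v).
have x0 : x + (0 : R) *: v = x by rewrite scale0r addr0.
have h s : 0 <= s ->
    dot (grad f (x + s *: v)) v - dot (grad f (x + 0 *: v)) v <= L1 * s.
  move=> s0; rewrite x0 -dotNl -dotDl.
  apply: le_trans (dot_le_enorm _ _) _; rewrite v1 mulr1.
  apply: le_trans (hL _ _) _.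
  by rewrite addrAC subrr add0r enormZ v1 mulr1 ger0_norm.
by have := taylor1_le D h t0; rewrite x0.
Qed.

Lemma grad_taylor L3 x v w t : third_deriv_lipschitz f L3 ->
  enorm v = 1 -> enorm w = 1 -> 0 <= t ->
  `|dot (grad f (x + t *: v)) w - (dot (grad f x) w + t * D2 f x w v
     + t ^+ 2 / 2 * D3 f x w v v)| <= L3 * t ^+ 3 / 6.
Proof.
move=> hL v1 w1 t0; have [_ d2 d3 _] := f_C3.
have D s := @is_derive_line _ _ (fun y => dot (grad f y) w)
  (fun y => D2 f y w v) x v s.
have D' s := @is_derive_line _ _ (fun y => D2 f y w v)
  (fun y => D3 f y w v v) x v s (d3 w v) (fun=> erefl).
have x0 : x + (0 : R) *: v = x by rewrite scale0r addr0.
have gE : (fun y => dot (grad f y) w) = (fun y => D1 f y w).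
  by apply: funext => y; rewrite -dot_grad.
have {}D s : is_derive s (1 : R) (fun s => dot (grad f (x + s *: v)) w)
    (D2 f (x + s *: v) w v).
  by apply: D => y; rewrite gE.
have hn s : 0 <= s -> enorm (x + s *: v - x) = s.
  by move=> s0; rewrite addrAC subrr add0r enormZ v1 mulr1 ger0_norm.
have h s : 0 <= s ->
    `|D3 f (x + s *: v) w v v - D3 f (x + 0 *: v) w v v| <= L3 * s.
  (* The Lipschitz condition bounds a signed difference; exchanging the two points gives the other
     sign. *)
  move=> s0; rewrite x0 ler_norml lerNl opprB; apply/andP; split.
  - apply: le_trans (_ : L3 * enorm (x - (x + s *: v)) <= _); last first.
      by rewrite -enormN opprB hn.
    by apply: hL; rewrite ?v1 ?w1.
  - apply: le_trans (_ : L3 * enorm (x + s *: v - x) <= _); last by rewrite hn.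
    by apply: hL; rewrite ?v1 ?w1.
by have := taylor2_norm D D' h t0; rewrite x0.
Qed.

End Objective.

(** * Recursive processes driven by independent samples *)

Section ImageMeasure.
Context {d d' : measure_display} {T1 : measurableType d}
  {T2 : measurableType d'} {R : realType}.

Definition image_measure (m : {measure set T1 -> \bar R}) (f : T1 -> T2)
    (mf : measurable_fun setT f) : {measure set T2 -> \bar R} :=
  measure_function_pushforward__canonical__measure_function_Measure m mf.

Definition mfun_of (f : T1 -> T2) (mf : measurable_fun setT f) :
  {mfun T1 >-> T2} := HB.pack f (isMeasurableFun.Build _ _ _ _ f mf).

Lemma measurable_preimage (f : T1 -> T2) A :
  measurable_fun setT f -> measurable A -> measurable (f @^-1` A).
Proof. by move=> mf mA; rewrite -[X in measurable X]setTI; exact: mf. Qed.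

End ImageMeasure.

Section RecursiveProcess.
Context {R : realType} {d : measure_display} {Omega : measurableType d}
  (P : probability Omega R).
Context {dX : measure_display} {Xi : measurableType dX}
  (mu : probability Xi R) (xi : nat -> Omega -> Xi).
Hypothesis xi_meas : forall k, measurable_fun setT (xi k).
Hypothesis xi_law : forall k A, measurable A -> P (xi k @^-1` A) = mu A.
Hypothesis xi_indep : mutually_independent P xi.
Context {dT : measure_display} {T : measurableType dT}.
Variables (S : nat -> Omega -> T) (step : nat -> T * Xi -> T) (s0 : T).
Hypothesis S0 : forall w, S 0%N w = s0.
Hypothesis SS : forall k w, S k.+1 w = step k (S k w, xi k w).
Hypothesis step_meas : forall k, measurable_fun setT (step k).

Lemma measurable_process k : measurable_fun setT (S k).
Proof.
elim: k => [|k ih].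
  by rewrite (_ : S 0%N = cst s0); [exact: measurable_cst|exact/funext].
rewrite (_ : S k.+1 = step k \o (fun w => (S k w, xi k w))).
  by apply: measurableT_comp => //; exact: measurable_fun_pair.
by apply: funext => w; rewrite SS.
Qed.

Let cylinder (s : seq nat) (A : nat -> set Xi) : set Omega :=
  \bigcap_(i in [set` s]) (xi i @^-1` A i).

Let measurable_cylinder s A :
  (forall i, measurable (A i)) -> measurable (cylinder s A).
Proof.
move=> mA; apply: bigcap_measurableType => // i _.
exact: measurable_preimage.
Qed.

(** Absorbs a constraint on sample [k] into the cylinder, so that rectangles for (state, sample)
    fall under the induction hypothesis of [process_indep]. *)
Let pair_rect k s (U : set T) (B : set Xi) A : k \notin s ->
  (fun w => (S k w, xi k w)) @^-1` (U `*` B) `&` cylinder s A =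
  S k @^-1` U `&` cylinder (k :: s) (fun i => if i == k then B else A i).
Proof.
move=> ks; apply/seteqP; split => w /=.
- move=> [[SU xB] H]; split => // i /=; rewrite inE => /orP[/eqP ->|si].
    by rewrite eqxx.
  by case: eqP => [ik|_]; [rewrite -ik si in ks|exact: H].
- move=> [SU H]; split; first split => //.
    by have := H k; rewrite /= inE eqxx => /(_ isT).
  move=> i /= si; have := H i; rewrite /= inE si orbT => /(_ isT).
  by case: eqP => [ik|//]; rewrite -ik si in ks.
Qed.

(** The state at [k] depends only on samples of index below [k]. The statement ranges over all later
    cylinders because the induction step moves index [k] into the cylinder. *)
Lemma process_indep k U s A : measurable U -> uniq s ->
  all (fun i => (k <= i)%N) s -> (forall i, measurable (A i)) ->
  P (S k @^-1` U `&` cylinder s A) = (P (S k @^-1` U) * P (cylinder s A))%E.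
Proof.
elim: k U s A => [|k ih] U s A mU us ks mA.
  have [Us|Us] := pselect (U s0).
  - rewrite (_ : S 0%N @^-1` U = setT); last first.
      by apply/seteqP; split => w //= _; rewrite S0.
    by rewrite setTI probability_setT mul1e.
  - rewrite (_ : S 0%N @^-1` U = set0); last first.
      by apply/seteqP; split => w //=; rewrite S0.
    by rewrite set0I measure0 mul0e.
have kNs : k \notin s.
  by apply/negP => kins; move/allP: ks => /(_ _ kins); rewrite ltnn.
have ks' : all (fun i => (k <= i)%N) (k :: s).
  by rewrite /= leqnn; apply: sub_all ks => i; exact: ltnW.
pose Y w := (S k w, xi k w).
have mY : measurable_fun setT Y.
  by apply: measurable_fun_pair => //; exact: measurable_process.
have mE := measurable_cylinder s mA; set E := cylinder s A in mE *.
have PE_fin : P E \is a fin_num by exact: fin_num_measure.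
have rP : 0 <= fine (P E) by rewrite fine_ge0.
pose r : {nonneg R} := NngNum rP.
(* The preimage of [U] under [step k] need not be a rectangle. The law of the pair restricted to
   [E], and its law scaled by P(E), both agree on rectangles with the product of [law] and [mu];
   uniqueness of product measures extends this to all measurable sets. *)
pose law := mscale r (distribution P (mfun_of (measurable_process k))).
pose joint := mscale r (image_measure P mY).
pose jointE := image_measure (mrestr P mE) mY.
have rE : r%:num%:E = P E by rewrite /= fineK.
have cyl1 B C : measurable B -> measurable C ->
  P (Y @^-1` (B `*` C)) = (P (S k @^-1` B) * mu C)%E.
  move=> mB mC; have := pair_rect B C (fun=> setT) (isT : k \notin [::]).
  rewrite {1}/cylinder (_ : [set` [::]] = set0); last by apply/seteqP; split.
  rewrite bigcap_set0 setIT => ->; rewrite ih//=; last 2 first.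
  - by rewrite leqnn.
  - by move=> i; case: ifP.
  rewrite /cylinder xi_indep//; last by move=> i; case: ifP.
  by rewrite big_seq1 eqxx xi_law.
have h1 B C : measurable B -> measurable C ->
    joint (B `*` C) = (law B * mu C)%E.
  move=> mB mC; rewrite /joint /law /mscale -muleA; congr (_ * _)%E.
  exact: cyl1.
have h2 B C : measurable B -> measurable C ->
    jointE (B `*` C) = (law B * mu C)%E.
  move=> mB mC; rewrite /law /mscale rE.
  rewrite -[LHS]/(P (Y @^-1` (B `*` C) `&` E)) pair_rect//.
  rewrite ih//; last 2 first.
  - by rewrite /= kNs.
  - by move=> i; case: ifP.
  rewrite {1}/cylinder xi_indep//; last 2 first.
  - by rewrite /= kNs.
  - by move=> i; case: ifP.
  rewrite big_cons eqxx xi_law//.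
  rewrite (_ : (\prod_(j <- s) _)%E = P E); last first.
    rewrite /E /cylinder xi_indep//; apply: eq_big_seq => i si.
    by case: eqP => // ik; rewrite -ik si in kNs.
  by rewrite (muleC (mu C)) muleA (muleC (P (S k @^-1` B))).
have mX : measurable (step k @^-1` U) by exact: measurable_preimage.
have e : P (Y @^-1` (step k @^-1` U) `&` E) =
    (P E * P (Y @^-1` (step k @^-1` U)))%E.
  rewrite -rE.
  exact: etrans (esym (product_measure_unique h2 mX))
    (product_measure_unique h1 mX).
move: e.
have -> : Y @^-1` (step k @^-1` U) = S k.+1 @^-1` U.
  by apply/seteqP; split => w /=; rewrite SS.
by move=> ->; rewrite muleC.
Qed.

(** Plays the part of conditional expectation: the pair (state, fresh sample) has a product law, so
    Tonelli integrates the sample with the state frozen. *)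
Lemma ge0_integral_process (k : nat) (F : T * Xi -> \bar R) :
  measurable_fun setT F -> (forall z, (0 <= F z)%E) ->
  (\int[P]_w F (S k w, xi k w) =
   \int[P]_w \int[mu]_s F (S k w, s))%E.
Proof.
move=> mF F0; have mS := measurable_process k.
pose Y w := (S k w, xi k w).
have mY : measurable_fun setT Y by exact: measurable_fun_pair.
pose law := distribution P (mfun_of mS).
pose joint := image_measure P mY.
have h B C : measurable B -> measurable C ->
    joint (B `*` C) = (law B * mu C)%E.
  move=> mB mC; have := pair_rect B C (fun=> setT) (isT : k \notin [::]).
  rewrite {1}/cylinder (_ : [set` [::]] = set0); last by apply/seteqP; split.
  rewrite bigcap_set0 setIT -[joint _]/(P (Y @^-1` (B `*` C))) => ->.
  rewrite process_indep//=; last 2 first.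
  - by rewrite leqnn.
  - by move=> i; case: ifP.
  rewrite /cylinder xi_indep//; last by move=> i; case: ifP.
  by rewrite big_seq1 eqxx xi_law.
transitivity (\int[joint]_z F z)%E.
  by rewrite ge0_integral_pushforward.
transitivity (\int[law \x mu]_z F z)%E.
  apply: eq_measure_integral => A mA _.
  exact: esym (product_measure_unique h mA).
rewrite fubini_tonelli1// /law /distribution ge0_integral_pushforward//.
- exact: measurable_fun_fubini_tonelli_F.
- by move=> z _; apply: integral_ge0.
Qed.

Lemma ge0_integral_process_le k (F : T * Xi -> \bar R) (g : Omega -> \bar R) :
  measurable_fun setT F -> (forall z, (0 <= F z)%E) -> measurable_fun setT g ->
  (forall w, (\int[mu]_s F (S k w, s) <= g w)%E) ->
  (\int[P]_w F (S k w, xi k w) <= \int[P]_w g w)%E.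
Proof.
move=> mF F0 mg Fg; rewrite ge0_integral_process//.
apply: ge0_le_integral => //.
- by move=> w _; apply: integral_ge0.
- exact: (measurableT_comp
    (@measurable_fun_fubini_tonelli_F _ _ _ _ _ mu _ mF F0)
    (measurable_process k)).
Qed.

End RecursiveProcess.

(** * Measurability and noise *)

Section RowMeasurability.
Context {R : realType} {n : nat}.

(* The matrix type carries no sigma-algebra in the library, so a row-vector
   valued map is called measurable when its coordinates are, and row vectors
   are transported to tuples where a measurable type is needed. *)
Definition vec (t : n.-tuple R) : 'rV[R]_n := \row_(j < n) tnth t j.
Definition tup (v : 'rV[R]_n) : n.-tuple R := [tuple v ord0 i | i < n].

Lemma tupK v : vec (tup v) = v.
Proof. by apply/rowP => i; rewrite mxE tnth_mktuple. Qed.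

Context {d : measure_display} {X : measurableType d}.
Definition row_measurable (F : X -> 'rV[R]_n) : Prop :=
  forall i, measurable_fun setT (fun x => F x ord0 i).

Lemma measurable_tup F :
  row_measurable F -> measurable_fun setT (fun x => tup (F x)).
Proof.
move=> mF; apply/measurable_fun_tnthP => i.
by rewrite (_ : _ \o _ = (fun x => F x ord0 i))//; apply: funext => x /=;
  rewrite tnth_mktuple.
Qed.

Lemma row_measurable_vec (F : X -> n.-tuple R) :
  measurable_fun setT F -> row_measurable (fun x => vec (F x)).
Proof.
move=> mF i; rewrite (_ : (fun _ => _) = (fun x => tnth (F x) i)).
  exact: (measurableT_comp (measurable_tnth i) mF).
by apply: funext => x; rewrite mxE.
Qed.

Lemma row_measurableD F1 F2 : row_measurable F1 -> row_measurable F2 ->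
  row_measurable (fun x => F1 x + F2 x).
Proof.
move=> m1 m2 i.
rewrite (_ : (fun _ => _) = (fun x => F1 x ord0 i + F2 x ord0 i)).
  exact: measurable_funD.
by apply: funext => x; rewrite mxE.
Qed.

Lemma row_measurableZ (a : X -> R) F : measurable_fun setT a ->
  row_measurable F -> row_measurable (fun x => a x *: F x).
Proof.
move=> ma mF i; rewrite (_ : (fun _ => _) = (fun x => a x * F x ord0 i)).
  exact: measurable_funM.
by apply: funext => x; rewrite mxE.
Qed.

Lemma row_measurableN F : row_measurable F -> row_measurable (fun x => - F x).
Proof.
move=> mF; rewrite (_ : (fun _ => _) = (fun x => (-1) *: F x)).
  exact: row_measurableZ.
by apply: funext => x; rewrite scaleN1r.
Qed.

Lemma row_measurable_sum q (F : 'I_q -> X -> 'rV[R]_n) :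
  (forall t, row_measurable (F t)) -> row_measurable (fun x => \sum_t F t x).
Proof.
move=> mF i; rewrite (_ : (fun _ => _) = (fun x => \sum_t F t x ord0 i)).
  by apply: measurable_sum => t; exact: mF.
by apply: funext => x; rewrite summxE.
Qed.

Lemma measurable_enorm F :
  row_measurable F -> measurable_fun setT (fun x => enorm (F x)).
Proof.
move=> mF; apply: (measurableT_comp (continuous_measurable_fun
  (@sqrt_continuous R))) => /=.
by apply: measurable_sum => i; apply: measurable_funX; exact: mF.
Qed.

Lemma measurable_inv_enorm F :
  row_measurable F -> measurable_fun setT (fun x => (enorm (F x))^-1).
Proof.
(* Inversion is discontinuous at 0, but on nonnegative reals it equals the power -1, also at 0 where
   both are 0. *)
move=> mF; rewrite (_ : (fun _ => _) = (fun x => enorm (F x) `^ (-1))).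
  exact: (measurableT_comp (measurable_powR (-1)) (measurable_enorm mF)).
by apply: funext => x; rewrite powR_inv1// enorm_ge0.
Qed.

End RowMeasurability.

(** * The algorithm as a measurable recursion on tuples *)

Section AlgorithmProcess.
Context {R : realType} {n : nat} {dX : measure_display}
  {Xi : measurableType dX} (mu : probability Xi R).
Variables (G : 'rV[R]_n -> Xi -> 'rV[R]_n) (gf : 'rV[R]_n -> 'rV[R]_n).
Hypothesis G_unb : forall x (i : 'I_n),
  (\int[mu]_s (G x s ord0 i)%:E = (gf x ord0 i)%:E)%E.
Hypothesis G_meas : forall i : 'I_n, measurable_fun setT
  (fun p : n.-tuple R * Xi => G (vec p.1) p.2 ord0 i).

Lemma row_measurable_G {d} {X : measurableType d} F (h : X -> Xi) :
  row_measurable F -> measurable_fun setT h ->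
  row_measurable (fun x => G (F x) (h x)).
Proof.
move=> mF mh i; rewrite (_ : (fun _ => _) =
  (fun p : n.-tuple R * Xi => G (vec p.1) p.2 ord0 i) \o
  (fun x => (tup (F x), h x))).
  apply: measurableT_comp => //.
  by apply: measurable_fun_pair => //; exact: measurable_tup.
by apply: funext => x /=; rewrite tupK.
Qed.

(* By unbiasedness the gradient is a partial integral of the jointly
   measurable G, so Fubini-Tonelli applies to its two signed parts. *)
Lemma row_measurable_grad {d} {X : measurableType d} (F : X -> 'rV[R]_n) :
  row_measurable F -> row_measurable (fun x => gf (F x)).
Proof.
move=> mF i.
suff mg : measurable_fun setT (fun t => gf (vec t) ord0 i).
  rewrite (_ : (fun _ => _) =
    (fun t => gf (vec t) ord0 i) \o (fun x => tup (F x))).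
    by apply: measurableT_comp => //; exact: measurable_tup.
  by apply: funext => x /=; rewrite tupK.
apply/measurable_EFinP.
pose g (p : n.-tuple R * Xi) := (G (vec p.1) p.2 ord0 i)%:E.
have mg : measurable_fun setT g by apply/measurable_EFinP; exact: G_meas.
rewrite (_ : _ \o _ = fun t => (fubini_F mu g^\+ t - fubini_F mu g^\- t)%E).
  apply: emeasurable_funB.
  - apply: measurable_fun_fubini_tonelli_F => [|p]; last exact: funepos_ge0.
    exact: measurable_funepos.
  - apply: measurable_fun_fubini_tonelli_F => [|p]; last exact: funeneg_ge0.
    exact: measurable_funeneg.
apply: funext => t /=; rewrite -G_unb integralE.
by congr (_ - _)%E; apply: eq_integral => s _; rewrite ?funeposE ?funenegE.
Qed.

Variables (q : nat) (eta : nat -> R) (gam theta : nat -> 'I_q -> R).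

Let T := (n.-tuple R * n.-tuple R * n.-tuple R)%type.

Definition vec3 (t : T) := (vec t.1.1, vec t.1.2, vec t.2).
Definition tup3 (v : 'rV[R]_n * 'rV[R]_n * 'rV[R]_n) : T :=
  (tup v.1.1, tup v.1.2, tup v.2).

Lemma tup3K v : vec3 (tup3 v) = v.
Proof. by case: v => -[x y] m; rewrite /vec3 /tup3 /= !tupK. Qed.

(** With [Xi] itself as the probability space and [id] as every sample map, a step becomes a
    function of (state, sample). *)
Definition tup_step (k : nat) (p : T * Xi) : T :=
  tup3 (alg1_step eta gam theta G (fun=> id) k p.2 (vec3 p.1)).

Lemma measurable_tup_step k : measurable_fun setT (tup_step k).
Proof.
have mx : row_measurable (fun p : T * Xi => vec p.1.1.1).
  apply: row_measurable_vec.
  exact: (measurableT_comp measurable_fst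
    (measurableT_comp measurable_fst measurable_fst)).
have my : row_measurable (fun p : T * Xi => vec p.1.1.2).
  apply: row_measurable_vec.
  exact: (measurableT_comp measurable_snd
    (measurableT_comp measurable_fst measurable_fst)).
have mm : row_measurable (fun p : T * Xi => vec p.1.2).
  apply: row_measurable_vec.
  exact: (measurableT_comp measurable_snd measurable_fst).
set th := theta_prev theta k; set ga := gam_prev gam k.
have mz t : row_measurable (fun p : T * Xi => vec p.1.1.1 +
    ((1 - ga t) / ga t) *: (vec p.1.1.1 - vec p.1.1.2)).
  apply: row_measurableD => //; apply: row_measurableZ => //.
  by apply: row_measurableD => //; exact: row_measurableN.
have mM : row_measurable (fun p : T * Xi =>
    (1 - \sum_t th t) *: vec p.1.2 + \sum_t th t *: G (vec p.1.1.1 +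
    ((1 - ga t) / ga t) *: (vec p.1.1.1 - vec p.1.1.2)) p.2).
  apply: row_measurableD; first exact: row_measurableZ.
  apply: row_measurable_sum => t; apply: row_measurableZ => //.
  exact: row_measurable_G.
apply: measurable_fun_pair; first apply: measurable_fun_pair.
- apply: measurable_tup => /=.
  apply: row_measurableD => //; apply: row_measurableN.
  apply: row_measurableZ => //; apply: measurable_funM => //.
  exact: measurable_inv_enorm.
- exact: measurable_tup.
- exact: measurable_tup.
Qed.

(** After step k the state is (x^{k+1}, x^k, m^k), so the momentum is compared with the gradient at
    the second component. *)
Definition sqr_err (t : T) : R := enorm (vec t.2 - gf (vec t.1.2)) ^+ 2.

Lemma measurable_sqr_err : measurable_fun setT sqr_err.
Proof.
apply: measurable_funX; apply: measurable_enorm.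
apply: row_measurableD.
  by apply: row_measurable_vec; exact: measurable_snd.
apply: row_measurableN; apply: row_measurable_grad; apply: row_measurable_vec.
exact: (measurableT_comp measurable_snd measurable_fst).
Qed.

End AlgorithmProcess.

(** * Second moment under two possibly correlated noises *)

Section Noise.
Context {R : realType} {n : nat} {dX : measure_display}
  {Xi : measurableType dX} (mu : probability Xi R) (sigma : R).

Definition noise (N : Xi -> 'rV[R]_n) : Prop :=
  [/\ forall i, mu.-integrable setT (fun s => (N s ord0 i)%:E),
      forall i, (\int[mu]_s (N s ord0 i)%:E = 0)%E &
      (\int[mu]_s (enorm (N s) ^+ 2)%:E <= (sigma ^+ 2)%:E)%E].

Lemma noise_row_measurable N : noise N -> row_measurable N.
Proof.
by case=> iN _ _ i; apply/measurable_EFinP; apply: measurable_int (iN i).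
Qed.

Lemma integrable_dot N (v : 'rV[R]_n) : noise N ->
  mu.-integrable setT (fun s => (dot v (N s))%:E) /\
  (\int[mu]_s (dot v (N s))%:E = 0)%E.
Proof.
case=> iN N0 _.
have E : (fun s => (dot v (N s))%:E) =
    (fun s => \sum_(i < n) ((v ord0 i)%:E * (N s ord0 i)%:E)%E).
  by apply: funext => s; rewrite -sumEFin; apply: eq_bigr => i _; rewrite EFinM.
split; rewrite E.
  by apply: integrable_sum => // i _; exact: integrableZl.
rewrite integral_sum//; last by move=> i; exact: integrableZl.
by rewrite big1// => i _; rewrite integralZl// N0 mule0.
Qed.

(** Expanding around the deterministic [v], the cross terms [D] have mean zero. The correlation of
    [N1] and [N2] is unknown, so their combination is bounded by [Q] through [sqr_enormD_le]. *)
Lemma sqr_noise_le (v : 'rV[R]_n) (N1 N2 : Xi -> 'rV[R]_n) (a b : R) :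
  noise N1 -> noise N2 ->
  (\int[mu]_s (enorm (v + a *: N1 s + b *: N2 s) ^+ 2)%:E <=
   (enorm v ^+ 2 + (2 * a ^+ 2 + 2 * b ^+ 2) * sigma ^+ 2)%:E)%E.
Proof.
move=> n1 n2.
have mN2 N : noise N -> measurable_fun setT (fun s => (enorm (N s) ^+ 2)%:E).
  move=> nN; apply/measurable_EFinP; apply: measurable_funX.
  by apply: measurable_enorm; exact: noise_row_measurable.
have iN2 N : noise N -> mu.-integrable setT (fun s => (enorm (N s) ^+ 2)%:E).
  move=> nN; apply/integrableP; split; first exact: mN2.
  under eq_integral do rewrite gee0_abs ?lee_fin ?sqr_ge0//.
  by case: nN => _ _ /le_lt_trans; apply; rewrite ltry.
have [i1 e1] := integrable_dot ((2 * a) *: v) n1.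
have [i2 e2] := integrable_dot ((2 * b) *: v) n2.
pose D s := ((dot ((2 * a) *: v) (N1 s))%:E + (dot ((2 * b) *: v) (N2 s))%:E)%E.
pose Q s := ((2 * a ^+ 2)%:E * (enorm (N1 s) ^+ 2)%:E +
  (2 * b ^+ 2)%:E * (enorm (N2 s) ^+ 2)%:E)%E.
have iD : mu.-integrable setT D by exact: integrableD.
have iQ : mu.-integrable setT Q.
  by apply: integrableD => //; apply: integrableZl => //; exact: iN2.
have ic : mu.-integrable setT (fun=> (enorm v ^+ 2)%:E).
  exact: finite_measure_integrable_cst.
have icD : mu.-integrable setT (fun s => (enorm v ^+ 2)%:E + D s)%E.
  exact: integrableD.
have iall : mu.-integrable setT (fun s => (enorm v ^+ 2)%:E + D s + Q s)%E.
  exact: integrableD.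
have mB : measurable_fun setT
    (fun s => (enorm (v + a *: N1 s + b *: N2 s) ^+ 2)%:E).
  apply/measurable_EFinP; apply: measurable_funX; apply: measurable_enorm.
  apply: row_measurableD; last first.
    by apply: row_measurableZ => //; exact: noise_row_measurable.
  apply: row_measurableD; first by move=> i; exact: measurable_cst.
  by apply: row_measurableZ => //; exact: noise_row_measurable.
have le_pt s : ((enorm (v + a *: N1 s + b *: N2 s) ^+ 2)%:E <=
    (enorm v ^+ 2)%:E + D s + Q s)%E.
  rewrite /D /Q -!EFinM -!EFinD lee_fin -addrA.
  have := sqr_enormD_le (a *: N1 s) (b *: N2 s).
  rewrite !enormZ !exprMn !real_normK ?num_real//.
  have wE : dot v (a *: N1 s + b *: N2 s) = a * dot v (N1 s) + b * dot v (N2 s).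
    by rewrite dotDr !dotZr.
  move: (_ + _ *: _) wE => w wE.
  have -> : enorm (v + w) ^+ 2 = enorm v ^+ 2 + 2 * dot v w + enorm w ^+ 2.
    by rewrite !sqr_enorm dotDl !dotDr (dotC w v); ring.
  by rewrite wE !dotZl; lra.
apply: (@le_trans _ _ (\int[mu]_s ((enorm v ^+ 2)%:E + D s + Q s))%E).
  apply: ge0_le_integral => //.
  - by move=> s _; rewrite lee_fin sqr_ge0.
  - exact: measurable_int iall.
rewrite integralD// integralD// integral_cst//.
have m1 : (mu [set: Xi] = 1)%E := probability_setT mu.
rewrite [X in (_ * X + _ + _ <= _)%E](_ : _ = 1%E) ?mule1; last exact: m1.
rewrite [X in (_ + X + _)%E](_ : _ = 0)%E; last first.
  by rewrite integralD// e1 e2 adde0.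
rewrite adde0 EFinD leeD2lE// integralD//; last 2 first.
- by apply: integrableZl => //; exact: iN2.
- by apply: integrableZl => //; exact: iN2.
rewrite !integralZl//; try exact: iN2.
have [_ _ v1] := n1; have [_ _ v2] := n2.
have le1 (c : R) I : 0 <= c -> (I <= (sigma ^+ 2)%:E)%E ->
    (c%:E * I <= (c * sigma ^+ 2)%:E)%E.
  by move=> c0 hI; rewrite (EFinM c); apply: lee_wpmul2l.
rewrite [in leRHS]mulrDl [leRHS]EFinD; apply: leeD; apply: le1 => //.
- by rewrite mulr_ge0// sqr_ge0.
- by rewrite mulr_ge0// sqr_ge0.
Qed.

End Noise.

(** * Taylor cancellation in the momentum drift *)

Section Bias.
Context {R : realType} {n : nat} (f : 'rV[R]_n -> R).
Hypothesis f_C3 : C3 f.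

(* The weights annihilate the terms of order 1 and 2 of the Taylor expansion
   at y, leaving only the three remainders. *)
Lemma momentum_bias (L3 s t a b : R) (y v : 'rV[R]_n) :
  third_deriv_lipschitz f L3 -> 0 < L3 -> enorm v = 1 -> 1 <= s -> 0 <= t ->
  a = (2 * s - 1) / s ^+ 2 -> b = (1 - s) / (2 * s ^+ 2) ->
  enorm ((1 - (a + b)) *: grad f y + a *: grad f (y + (t * s) *: v) +
    b *: grad f (y + (t * (2 * s)) *: v) - grad f (y + t *: v))
  <= L3 * t ^+ 3 * s ^+ 2.
Proof.
move=> hL L0 v1 s1 t0 aE bE; have s0 : 0 < s by lra.
apply: enorm_le_dot => [|w w1].
  by rewrite !mulr_ge0 ?exprn_ge0//; lra.
have tay u : 0 <= u -> `|dot (grad f (y + u *: v)) w - (dot (grad f y) w +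
    u * D2 f y w v + u ^+ 2 / 2 * D3 f y w v v)| <= L3 * u ^+ 3 / 6.
  exact: grad_taylor.
move: (grad f) tay => gf tay; rewrite !dotDl dotNl !dotZl.
have ts0 : 0 <= t * s by rewrite mulr_ge0// ltW.
have t2s0 : 0 <= t * (2 * s) by rewrite !mulr_ge0// ltW.
move: (tay _ t0) (tay _ ts0) (tay _ t2s0).
move: (dot (gf (y + t *: v)) w) => g1.
move: (dot (gf (y + (t * s) *: v)) w) => g2.
move: (dot (gf (y + (t * (2 * s)) *: v)) w) => g3.
move: (dot _ w) (D2 _ _ _ _) (D3 _ _ _ _ _) => g0 h1 h2.
pose rem g u := g - (g0 + u * h1 + u ^+ 2 / 2 * h2).
rewrite -/(rem g1 t) -/(rem g2 (t * s)) -/(rem g3 (t * (2 * s))).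
have -> : (1 - (a + b)) * g0 + a * g2 + b * g3 - g1 =
    a * rem g2 (t * s) + b * rem g3 (t * (2 * s)) - rem g1 t.
  by rewrite /rem aE bE; field; rewrite gt_eqF.
move: (rem g1 t) (rem g2 _) (rem g3 _) => r1 r2 r3.
rewrite !ler_norml => /andP[b1 c1] /andP[b2 c2] /andP[b3 c3].
(* As b <= 0, its remainder is bounded from below. The three bounds add up to L3 t^3 (6 s^2 - 5 s +
   1) / 6, at most L3 t^3 s^2 since s >= 1. *)
have a0 : 0 <= a by rewrite aE divr_ge0 ?exprn_ge0//; lra.
have b0 : 0 <= - b by rewrite bE -mulNr divr_ge0 ?mulr_ge0 ?exprn_ge0//; lra.
have A := ler_wpM2l a0 c2; have B := ler_wpM2l b0 b3.
apply: (@le_trans _ _ (a * (L3 * (t * s) ^+ 3 / 6) +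
  - b * (L3 * (t * (2 * s)) ^+ 3 / 6) + L3 * t ^+ 3 / 6)); first lra.
have -> : a * (L3 * (t * s) ^+ 3 / 6) +
    - b * (L3 * (t * (2 * s)) ^+ 3 / 6) + L3 * t ^+ 3 / 6 =
   L3 * t ^+ 3 * (s ^+ 2 - (5 * s - 1) / 6).
  by rewrite aE bE; field; rewrite gt_eqF.
by apply: ler_wpM2l; [rewrite mulr_ge0 ?exprn_ge0// ltW|lra].
Qed.

End Bias.

(** * Rates *)

Section Rates.
Context {R : realType}.

Lemma ln_ge1BV (x : R) : 0 < x -> 1 - x^-1 <= ln x.
Proof.
move=> x0; have := @le_ln1Dx _ (x^-1 - 1); rewrite addrCA subrr addr0.
by rewrite lnV ?posrE// ltrBrDr addNr invr_gt0 => /(_ x0); lra.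
Qed.

Lemma ln_ge1 (x : R) : 4 <= x -> 1 <= ln x.
Proof.
move=> x4; have l2 : 1 - 2^-1 <= ln (2 : R) by apply: ln_ge1BV.
apply: (@le_trans _ _ (ln (2 * 2))).
  by rewrite lnM ?posrE//; lra.
by rewrite ler_ln ?posrE//; lra.
Qed.

(** Since 1/(k+3) <= ln((k+3)/(k+2)), the sum telescopes to at most ln((K+2)/2), and (K+2)/2 <=
    K. *)
Lemma sum_inv_le_ln (K : nat) : (2 <= K)%N ->
  \sum_(k < K) ((k + 3)%:R : R)^-1 <= ln K%:R.
Proof.
move=> K2; apply: (@le_trans _ _ (ln (K + 2)%:R - ln 2)).
  elim: K {K2} => [|K ih]; first by rewrite big_ord0 subrr.
  rewrite big_ord_recr/= addSn -[X in ln X%:R]addn1 -addnA.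
  have p2 : 0 < (K + 2)%:R :> R by rewrite ltr0n addnS.
  have p3 : 0 < (K + 3)%:R :> R by rewrite ltr0n addnS.
  have := @ln_ge1BV ((K + 3)%:R / (K + 2)%:R).
  rewrite divr_gt0// => /(_ isT); rewrite ln_div ?posrE// invf_div.
  have -> : (K + 2)%:R / (K + 3)%:R = 1 - (K + 3)%:R^-1 :> R.
    by move: p3; rewrite !natrD => p3; field; rewrite gt_eqF.
  by move: ih; rewrite (_ : (2 + 1)%N = 3%N)//; lra.
have K2' : (2 : R) <= K%:R by rewrite (ler_nat _ 2).
have p2 : (0 : R) < (K + 2)%:R by rewrite natrD; lra.
rewrite -ln_div ?posrE// ler_ln ?posrE ?divr_gt0//; last lra.
by rewrite natrD; lra.
Qed.

(* Bound ln by its tangent line at T. *)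
Lemma ln_le_of_ge (y T : R) : 0 < T -> 0 < y -> T * ln T <= y ->
  ln y <= 2 * y / T.
Proof.
move=> T0 y0 h; have yT : 0 < y / T by rewrite divr_gt0.
have := @le_ln1Dx _ (y / T - 1); rewrite addrCA subrr addr0.
rewrite ln_div ?posrE// ltrBrDr addNr => /(_ yT).
have : ln T <= y / T by rewrite ler_pdivlMr// mulrC.
by lra.
Qed.

(** All exponents of the schedules are multiples of 1/10, so they become integer powers of one real
    and real powers disappear from the estimates. *)
Definition rt (k : nat) : R := (k + 3)%:R `^ (1 / 10).

Lemma rt_ge1 k : 1 <= rt k.
Proof.
rewrite /rt -[leLHS](powRr0 (k + 3)%:R); apply: ler_powR; last lra.
by rewrite (ler_nat _ 1) addnS.
Qed.

Lemma rt_gt0 k : 0 < rt k.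
Proof. exact: lt_le_trans (rt_ge1 k). Qed.

Lemma powR_rt k (m : nat) (e : R) : e = m%:R / 10 ->
  (k + 3)%:R `^ e = rt k ^+ m.
Proof.
move=> ->; rewrite -powR_mulrn ?powR_ge0// /rt -powRrM; congr (_ `^ _).
by field.
Qed.

Lemma rt10 k : rt k ^+ 10 = (k + 3)%:R.
Proof. by rewrite -(@powR_rt k 10 1) ?powRr1// divff. Qed.

(** The tangent bound for the concave function u^(1/5) at k+3. It is proved by comparing fifth
    powers: (p + q)^5 >= p^5 + 5 p^4 q, and here 5 p^4 q = 1. *)
Lemma sqr_rtS_le k : rt k.+1 ^+ 2 <= rt k ^+ 2 + (rt k)^-1 ^+ 8 / 5.
Proof.
have r0 := rt_gt0 k; set i := (rt k)^-1; have i0 : 0 < i by rewrite invr_gt0.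
have ri : rt k * i = 1 by rewrite divff// gt_eqF.
have R0 := rt_gt0 k.+1.
rewrite leNgt; apply/negP => h.
have : rt k ^+ 10 + 1 < rt k.+1 ^+ 10.
  rewrite (exprM _ 2 5) (exprM (rt k.+1) 2 5).
  apply: le_lt_trans (_ : (rt k ^+ 2 + i ^+ 8 / 5) ^+ 5 < _); last first.
    by rewrite ltrXn2r// addr_ge0 ?divr_ge0 ?exprn_ge0// ltW.
  have -> : (rt k ^+ 2) ^+ 5 + 1 =
      (rt k ^+ 2) ^+ 5 + 5 * ((rt k ^+ 2) ^+ 4 * (i ^+ 8 / 5)).
    congr (_ + _).
    have e : (rt k ^+ 2) ^+ 4 * i ^+ 8 = 1.
      by rewrite -exprM (_ : (2 * 4)%N = 8%N)// -exprMn ri expr1n.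
    by rewrite [_ * (_ / 5)]mulrA e; field.
  have p0 : 0 <= rt k ^+ 2 by rewrite exprn_ge0// ltW.
  have q0 : 0 <= i ^+ 8 / 5 by rewrite divr_ge0// exprn_ge0// ltW.
  move: (rt k ^+ 2) (i ^+ 8 / 5) p0 q0 => p q p0 q0.
  have -> : (p + q) ^+ 5 = p ^+ 5 + 5 * (p ^+ 4 * q) +
     (10 * (p ^+ 3 * q ^+ 2) + 10 * (p ^+ 2 * q ^+ 3) +
      5 * (p * q ^+ 4) + q ^+ 5) by ring.
  by rewrite lerDl !addr_ge0 ?mulr_ge0 ?exprn_ge0// ler0n.
by rewrite !rt10 natr1 addSn ltxx.
Qed.

(* The Lyapunov function is rt k ^+ 2 * u k. *)
Lemma error_sum (u : nat -> R) (c : R) : 0 <= c -> (forall k, 0 <= u k) ->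
  (forall k, u k.+1 <= (1 - (rt k)^-1 ^+ 6) * u k + c * (rt k)^-1 ^+ 12) ->
  forall K, \sum_(k < K) 4 / 5 * (rt k)^-1 ^+ 4 * u k <=
    2 * u 0%N + 6 / 5 * c * \sum_(k < K) (rt k)^-1 ^+ 10.
Proof.
move=> c0 u0 uS.
have step k : 4 / 5 * (rt k)^-1 ^+ 4 * u k + rt k.+1 ^+ 2 * u k.+1 <=
    rt k ^+ 2 * u k + 6 / 5 * c * (rt k)^-1 ^+ 10.
  have r0 := rt_gt0 k; have r1 := rt_ge1 k; have := sqr_rtS_le k.
  have := uS k; set i := (rt k)^-1; set p := rt k.+1 ^+ 2.
  have i0 : 0 < i by rewrite invr_gt0.
  have i1 : i <= 1 by rewrite invf_le1.
  have p0 : 0 <= p by rewrite exprn_ge0// ltW// rt_gt0.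
  have ri : rt k * i = 1 by rewrite divff// gt_eqF.
  move=> us hp; have i_le m m' : (m <= m')%N -> i ^+ m' <= i ^+ m.
    by move=> mm; apply: ler_wiXn2l => //; exact: ltW.
  have ik m : 0 <= i ^+ m by rewrite exprn_ge0// ltW.
  have E1 : rt k ^+ 2 * i ^+ 6 = i ^+ 4.
    by rewrite (exprD i 2 4) mulrA -exprMn ri expr1n mul1r.
  have E2 : rt k ^+ 2 * i ^+ 12 = i ^+ 10.
    by rewrite (exprD i 2 10) mulrA -exprMn ri expr1n mul1r.
  (* Contraction gains r^2 r^-6 = r^-4, while growth of the weight costs at most r^-8 / 5 <= r^-4 /
     5; the factor 4/5 is what remains. *)
  have A1 : p * (1 - i ^+ 6) + 4 / 5 * i ^+ 4 <= rt k ^+ 2.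
    have h1 : 0 <= 1 - i ^+ 6 by rewrite subr_ge0 exprn_ile1// ltW.
    have := ler_wpM2r h1 hp.
    have -> : (rt k ^+ 2 + i ^+ 8 / 5) * (1 - i ^+ 6) =
      rt k ^+ 2 - rt k ^+ 2 * i ^+ 6 + i ^+ 8 / 5 - i ^+ 8 * i ^+ 6 / 5 by ring.
    rewrite E1; have := i_le 4%N 8%N isT.
    have : 0 <= i ^+ 8 * i ^+ 6 by rewrite mulr_ge0.
    by lra.
  have A2 : p * i ^+ 12 <= 6 / 5 * i ^+ 10.
    have := ler_wpM2r (ik 12%N) hp.
    have -> : (rt k ^+ 2 + i ^+ 8 / 5) * i ^+ 12 =
      rt k ^+ 2 * i ^+ 12 + i ^+ 20 / 5 by ring.
    rewrite E2; have := i_le 10%N 20%N isT.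
    by lra.
  have B1 := ler_wpM2r (u0 k) A1; have B2 := ler_wpM2l c0 A2.
  have B3 := ler_wpM2l p0 us.
  lra.
move=> K.
have : \sum_(k < K) 4 / 5 * (rt k)^-1 ^+ 4 * u k + rt K ^+ 2 * u K <=
    rt 0 ^+ 2 * u 0%N + 6 / 5 * c * \sum_(k < K) (rt k)^-1 ^+ 10.
  elim: K => [|K ih]; first by rewrite !big_ord0 mulr0 addr0 add0r.
  by rewrite !big_ord_recr/= mulrDr; have := step K; lra.
have p : 0 <= rt K ^+ 2 * u K by rewrite mulr_ge0// exprn_ge0// ltW// rt_gt0.
have : rt 0 ^+ 2 * u 0%N <= 2 * u 0%N.
  apply: ler_wpM2r => //.
  (* The initial weight is 3^(1/5) <= 2, as 3 <= 32. *)
  rewrite -(@ler_pXn2r _ 5) ?nnegrE ?exprn_ge0 ?ltW ?rt_gt0//.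
  by rewrite -exprM rt10 !exprS expr0 add0n; lra.
by lra.
Qed.

(** In terms of y = K^(3/10) the quantity is (5/3) M ln y / y. The threshold says y >= T ln T with T
    = 20 M / (3 eps), so it is at most (10/3) M / T = eps / 2. *)
Lemma rate_bound (M eps : R) (K : nat) : 8 <= M -> 0 < eps < 1 ->
  Num.max (((20 * M / (3 * eps)) * ln (20 * M / (3 * eps))) `^ (10 / 3)) 5
    <= K%:R ->
  (5 <= K)%N /\
  K%:R^-1 * (2 * K%:R `^ (7 / 10) * (M / 4 * ln K%:R)) <= eps.
Proof.
move=> M8 /andP[e0 e1]; rewrite ge_max => /andP[hK K5]; split.
  by rewrite -(ler_nat R).
have K0 : 0 < K%:R :> R by lra.
set T := 20 * M / (3 * eps) in hK.
have T1 : 1 < T by rewrite ltr_pdivlMr; lra.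
have T0 : 0 < T by lra.
have lT : 0 < ln T by rewrite ln_gt0.
set y := K%:R `^ (3 / 10) : R.
have y0 : 0 < y by rewrite powR_gt0.
have hy : T * ln T <= y.
  have TT : 0 <= T * ln T by rewrite mulr_ge0// ltW.
  have -> : T * ln T = ((T * ln T) `^ (10 / 3)) `^ (3 / 10).
    by rewrite -powRrM (_ : 10 / 3 * (3 / 10) = 1) ?powRr1//; field.
  by apply: ge0_ler_powR => //; rewrite ?nnegrE ?powR_ge0//; lra.
have ly := ln_le_of_ge T0 y0 hy.
have -> : ln (K%:R : R) = 10 / 3 * ln y.
  by rewrite /y ln_powR; field.
have E : (K%:R : R)^-1 * K%:R `^ (7 / 10) = y^-1.
  have -> : K%:R `^ (7 / 10) = K%:R / y :> R.
    apply: (canRL (mulfK (lt0r_neq0 y0))).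
    rewrite /y -powRD; last by rewrite gt_eqF// implybT.
    by rewrite (_ : 7 / 10 + 3 / 10 = 1) ?powRr1//; field.
  by rewrite mulrA mulVf ?mul1r// gt_eqF.
rewrite (_ : _ * _ = 5 / 3 * M * (ln y * ((K%:R : R)^-1 * K%:R `^ (7 / 10))));
  last by field; rewrite gt_eqF.
rewrite E.
have h : ln y / y <= 2 / T.
  by rewrite ler_pdivrMr// mulrAC.
apply: (@le_trans _ _ (5 / 3 * M * (2 / T))).
  by apply: ler_wpM2l => //; lra.
have -> : 5 / 3 * M * (2 / T) = eps / 2.
  by rewrite /T; field; rewrite !gt_eqF//; lra.
lra.
Qed.

End Rates.

Section Weights.
Context {R : realType}.

(** With s = r^6, a + b = (3s - 1) / (2 s^2); the first two bounds amount to s >= 1 and (2s - 1)(s -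
    1) >= 0. *)
Lemma weights_bounds (r a b : R) : 1 <= r ->
  a = (2 * r ^+ 6 - 1) / r ^+ 12 -> b = (1 - r ^+ 6) / (2 * r ^+ 12) ->
  [/\ r^-1 ^+ 6 <= a + b, a + b <= 1 &
      2 * a ^+ 2 + 2 * b ^+ 2 <= 17 / 2 * r^-1 ^+ 12].
Proof.
move=> r1 -> ->; have s1 : 1 <= r ^+ 6 by rewrite exprn_ege1.
rewrite !exprVn (_ : r ^+ 12 = (r ^+ 6) ^+ 2); last by rewrite -exprM.
move: (r ^+ 6) s1 => s s1; have s0 : 0 < s by lra.
have sn0 : s != 0 by rewrite gt_eqF.
have abE : (2 * s - 1) / s ^+ 2 + (1 - s) / (2 * s ^+ 2) =
  (3 * s - 1) / (2 * s ^+ 2) by field.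
have p : 0 < 2 * s ^+ 2 by rewrite mulr_gt0// exprn_gt0.
rewrite abE; split.
- rewrite ler_pdivlMr// (_ : s^-1 * (2 * s ^+ 2) = 2 * s); last by field.
  by lra.
- by rewrite ler_pdivrMr//; nra.
- rewrite (_ : 2 * _ + _ = (2 * (2 * s - 1) ^+ 2 + (s - 1) ^+ 2 / 2) / s ^+ 4);
    last by field.
  rewrite (_ : 17 / 2 / s ^+ 2 = 17 / 2 * s ^+ 2 / s ^+ 4); last by field.
  by rewrite ler_pM2r ?invr_gt0 ?exprn_gt0//; nra.
Qed.

Lemma error_arith (eA eB e t i6 i12 L s2 V : R) :
  eA <= (1 - t) * e + eB -> eB <= L * i12 -> V <= 17 / 2 * i12 * s2 ->
  i6 * e <= t * e -> eA + V <= (1 - i6) * e + (L + 17 / 2 * s2) * i12.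
Proof. by lra. Qed.

End Weights.

(** * One-step inequalities for the objective and the momentum error *)

Section OneStep.
Context {R : realType} {n : nat} (f : 'rV[R]_n -> R).
Hypothesis f_C3 : C3 f.

Lemma normalized_descent (L1 t a : R) (x m : 'rV[R]_n) : m != 0 ->
  (forall y z, enorm (grad f z - grad f y) <= L1 * enorm (z - y)) ->
  0 <= t -> 0 < a ->
  f (x + t *: (- (enorm m)^-1 *: m)) + t * enorm (grad f x) <=
    f x + a * enorm (m - grad f x) ^+ 2 + (t ^+ 2 / a + L1 * t ^+ 2 / 2).
Proof.
move=> m0 hL t0 a0; have p := enorm_gt0 m0.
have v1 : enorm (- (enorm m)^-1 *: m) = 1.
  by rewrite enormZ normrN ger0_norm ?invr_ge0 ?ltW// mulVf// gt_eqF.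
have := descent f_C3 x hL v1 t0.
move: (f _) (f x) (grad f x) => fx' fx g.
(* One error comes from replacing [g] by [m] in the inner product, the other from replacing the norm
   of [m] by that of [g]. *)
have gv : dot g (- (enorm m)^-1 *: m) <= 2 * enorm (m - g) - enorm g.
  have h1 : dot g m = enorm m ^+ 2 - dot (m - g) m.
    by rewrite sqr_enorm dotDl dotNl; ring.
  have h2 := dot_le_enorm (m - g) m.
  have h3 : enorm g <= enorm m + enorm (m - g).
    have := enormD_le m (- (m - g)).
    by rewrite enormN opprB (addrC m) subrK.
  have h4 : enorm m - enorm (m - g) <= (enorm m)^-1 * dot g m.
    by rewrite h1 -(ler_pM2l p) mulVKf ?gt_eqF//; lra.
  by rewrite dotZr mulNr; lra.
have := ler_wpM2l t0 gv.
have : 2 * t * enorm (m - g) <= a * enorm (m - g) ^+ 2 + t ^+ 2 / a.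
  rewrite -subr_ge0; set e := enorm (m - g).
  have -> : a * e ^+ 2 + t ^+ 2 / a - 2 * t * e = a * (e - t / a) ^+ 2.
    by field; rewrite gt_eqF.
  by rewrite mulr_ge0 ?sqr_ge0// ltW.
by lra.
Qed.

Context {dX : measure_display} {Xi : measurableType dX} (mu : probability Xi R).
Variables (G : 'rV[R]_n -> Xi -> 'rV[R]_n) (sigma L3 : R).
Hypothesis G_noise : forall x, noise mu sigma (fun s => G x s - grad f x).
Hypothesis L3_gt0 : 0 < L3.
Hypothesis f_L3 : third_deriv_lipschitz f L3.

Lemma momentum_error_step (r a b : R) (y v m : 'rV[R]_n) : 1 <= r ->
  enorm v = 1 ->
  a = (2 * r ^+ 6 - 1) / r ^+ 12 -> b = (1 - r ^+ 6) / (2 * r ^+ 12) ->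
  (\int[mu]_s (enorm ((1 - (a + b)) *: m +
     (a *: G (y + (r^-1 ^+ 7 * r ^+ 6) *: v) s +
      b *: G (y + (r^-1 ^+ 7 * (2 * r ^+ 6)) *: v) s) -
     grad f (y + r^-1 ^+ 7 *: v)) ^+ 2)%:E <=
   ((1 - r^-1 ^+ 6) * enorm (m - grad f y) ^+ 2 +
    (L3 ^+ 2 + 17 / 2 * sigma ^+ 2) * r^-1 ^+ 12)%:E)%E.
Proof.
move=> r1 v1 aE bE; have r0 : 0 < r by lra.
have i0 : 0 < r^-1 by rewrite invr_gt0.
have s1 : 1 <= r ^+ 6 by rewrite exprn_ege1.
have bias := momentum_bias f_C3 y f_L3 L3_gt0 v1 s1
  (exprn_ge0 7 (ltW i0)).
rewrite -exprM in bias.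
have {}bias := bias a b aE bE.
set z1 := y + (_ * r ^+ 6) *: v in bias *.
set z2 := y + (_ * (2 * _)) *: v in bias *.
set x := y + _ *: v in bias *.
set B := _ + _ - _ in bias.
(* [A] is the mean of the new error over the fresh sample: the contracted old error plus the Taylor
   drift [B]. *)
pose A := (1 - (a + b)) *: (m - grad f y) + B.
under eq_integral => s _.
  have -> : (1 - (a + b)) *: m + (a *: G z1 s + b *: G z2 s) - grad f x =
      A + a *: (G z1 s - grad f z1) + b *: (G z2 s - grad f z2).
    rewrite /A /B; move: (grad f y) (grad f x) (grad f z1) (grad f z2)
      (G z1 s) (G z2 s) => g1 g2 g3 g4 g5 g6.
    by apply/rowP => j; rewrite !mxE; ring.
  over.
apply: le_trans (sqr_noise_le A a b (G_noise z1) (G_noise z2)) _.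
rewrite lee_fin.
have [ab0 ab1 V] := weights_bounds r1 aE bE.
have i6 : 0 < r^-1 ^+ 6 by rewrite exprn_gt0.
have abp : 0 < a + b <= 1 by rewrite ab1 andbT (lt_le_trans i6).
have cvx := sqr_enorm_convex (m - grad f y) B abp.
have B2 : enorm B ^+ 2 / (a + b) <= L3 ^+ 2 * r^-1 ^+ 12.
  (* The drift bound L3 r^-21 r^12 = L3 r^-9, squared and divided by the lower bound r^-6 on a +
     b. *)
  have -> : L3 ^+ 2 * r^-1 ^+ 12 =
      (L3 * (r^-1 ^+ 7) ^+ 3 * r ^+ (6 * 2)) ^+ 2 / r^-1 ^+ 6.
    by rewrite !exprVn; field; rewrite gt_eqF.
  have ab_gt0 := lt_le_trans i6 ab0.
  apply: ler_pM; first exact: sqr_ge0.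
  - by rewrite invr_ge0 ltW.
  - have := enorm_ge0 B; move: (enorm B) bias => e he e0.
    by rewrite lerXn2r// nnegrE; exact: le_trans he.
  - by rewrite lef_pV2.
have V' := ler_wpM2r (sqr_ge0 sigma) V.
have E' := ler_wpM2r (sqr_ge0 (enorm (m - grad f y))) ab0.
exact: (error_arith cvx B2 V' E').
Qed.

End OneStep.

(** * Convergence *)

Section Trajectory.
Context {R : realType} {n : nat} {d : measure_display}
  {Omega : measurableType d} {dX : measure_display} {Xi : measurableType dX}
  {q : nat}.
Variables (x0 : 'rV[R]_n) (eta : nat -> R) (gam theta : nat -> 'I_q -> R)
  (G : 'rV[R]_n -> Xi -> 'rV[R]_n) (xi : nat -> Omega -> Xi).

Let st := alg1_state x0 eta gam theta G xi.
Let x := alg1_x x0 eta gam theta G xi.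
Let m := alg1_m x0 eta gam theta G xi.

Lemma alg1_stateS k w : st k.+1 w = (x k.+1 w, x k w, m k w).
Proof.
rewrite /x /m /alg1_x /alg1_m -/st; have : (st k.+1 w).1.2 = (st k w).1.1.
  by rewrite /st /= /alg1_step; case: (alg1_state _ _ _ _ _ _ k w) => -[].
by case: (st k.+1 w) => -[a b] c /= ->.
Qed.

Lemma alg1_xS k w :
  x k.+1 w = x k w + eta k *: (- (enorm (m k w))^-1 *: m k w).
Proof.
rewrite /x /m /alg1_x /alg1_m /= /alg1_step.
case: (alg1_state _ _ _ _ _ _ k w) => -[a b] c /=.
by rewrite scalerA mulrN scaleNr.
Qed.

Lemma tup3_stateS k w : tup3 (st k.+1 w) =
  tup_step G eta gam theta k (tup3 (st k w), xi k w).
Proof. by rewrite /tup_step tup3K. Qed.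

End Trajectory.

Section ErrorRecursion.
Context {R : realType}.

(** A real majorant of the expected squared error, which is a priori an extended real; the Lyapunov
    sum is run on this sequence. *)
Fixpoint err_bound (sigma c : R) (k : nat) : R :=
  if k is j.+1 then (1 - (rt j)^-1 ^+ 6) * err_bound sigma c j +
    c * (rt j)^-1 ^+ 12
  else sigma ^+ 2.

Lemma err_bound_ge0 sigma c k : 0 <= c -> 0 <= err_bound sigma c k.
Proof.
move=> c0; elim: k => [|k ih] /=; first exact: sqr_ge0.
have i0 : 0 <= (rt k)^-1 :> R by rewrite invr_ge0 ltW// rt_gt0.
apply: addr_ge0; apply: mulr_ge0 => //; last exact: exprn_ge0.
by rewrite subr_ge0 exprn_ile1// invf_le1 ?rt_gt0 ?rt_ge1.
Qed.

Lemma descent_arith (S a b F C T A t g q D i : R) :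
  S + a <= F + C * T + A -> b + t * g <= a + q + D -> D <= C * i ->
  S + t * g + b <= F + C * (T + i) + (A + q).
Proof. by rewrite mulrDr; lra. Qed.

End ErrorRecursion.

Section Convergence.
Context {R : realType} {n : nat} {d : measure_display}
  {Omega : measurableType d} (P : probability Omega R)
  {dX : measure_display} {Xi : measurableType dX} (mu : probability Xi R).
Variables (f : 'rV[R]_n -> R) (flow L1 L3 sigma : R)
  (G : 'rV[R]_n -> Xi -> 'rV[R]_n) (xi : nat -> Omega -> Xi) (x0 : 'rV[R]_n).
Hypothesis f_low : forall x, flow <= f x.
Hypothesis L1_gt0 : 0 < L1.
Hypothesis f_L1 : forall x y, enorm (grad f y - grad f x) <= L1 * enorm (y - x).
Hypothesis f_C3 : C3 f.
Hypothesis L3_gt0 : 0 < L3.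
Hypothesis f_L3 : third_deriv_lipschitz f L3.
Hypothesis G_unb : forall x (i : 'I_n),
  (\int[mu]_s (G x s ord0 i)%:E = (grad f x ord0 i)%:E)%E.
Hypothesis G_noise : forall x, noise mu sigma (fun s => G x s - grad f x).
Hypothesis G_meas : forall i : 'I_n, measurable_fun setT
  (fun p : n.-tuple R * Xi => G (vec p.1) p.2 ord0 i).
Hypothesis xi_meas : forall k, measurable_fun setT (xi k).
Hypothesis xi_law : forall k A, measurable A -> P (xi k @^-1` A) = mu A.
Hypothesis xi_indep : mutually_independent P xi.
Variables (eta : nat -> R) (gam theta : nat -> 'I_2 -> R).
Hypothesis etaE : forall k, eta k = (rt k)^-1 ^+ 7.
Hypothesis gam0 : forall k, gam k ord0 = (rt k ^+ 6)^-1.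
Hypothesis gam1 : forall k, gam k (lift ord0 ord0) = (2 * rt k ^+ 6)^-1.
Hypothesis theta0 : forall k,
  theta k ord0 = (2 * rt k ^+ 6 - 1) / rt k ^+ 12.
Hypothesis theta1 : forall k,
  theta k (lift ord0 ord0) = (1 - rt k ^+ 6) / (2 * rt k ^+ 12).

Let st := alg1_state x0 eta gam theta G xi.
Let x := alg1_x x0 eta gam theta G xi.
Let m := alg1_m x0 eta gam theta G xi.
Hypothesis m_neq0 : forall k w, m k w != 0.

Let c := L3 ^+ 2 + 17 / 2 * sigma ^+ 2.

Let c_ge0 : 0 <= c.
Proof. by have := sqr_ge0 L3; have := sqr_ge0 sigma; rewrite /c; lra. Qed.

Let measurable_state k : measurable_fun setT (fun w => tup3 (st k w)).
Proof.
apply: (measurable_process xi_meas (S := fun k w => tup3 (st k w))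
  (step := tup_step G eta gam theta) (s0 := tup3 (x0, x0, 0))) => //.
- by move=> j w; exact: tup3_stateS.
- by move=> j; exact: measurable_tup_step.
Qed.

Let measurable_error k :
  measurable_fun setT (fun w => enorm (m k w - grad f (x k w)) ^+ 2).
Proof.
rewrite (_ : (fun _ => _) = sqr_err (grad f) \o (fun w => tup3 (st k.+1 w))).
  by apply: measurableT_comp => //; exact: (measurable_sqr_err G_unb).
apply: funext => w; rewrite -[RHS]/(sqr_err (grad f) (tup3 (st k.+1 w))).
by rewrite /st alg1_stateS /sqr_err /= !tupK.
Qed.

Let measurable_grad k : measurable_fun setT (fun w => enorm (grad f (x k w))).
Proof.
apply: measurable_enorm; apply: (row_measurable_grad G_unb) => //.
rewrite (_ : x k = (fun w => vec (tup3 (st k w)).1.1)).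
  apply: row_measurable_vec.
  exact: (measurableT_comp measurable_fst
    (measurableT_comp measurable_fst (measurable_state k))).
by apply: funext => w; rewrite /= tupK.
Qed.

Let momentum_error0 w :
  (\int[mu]_s (sqr_err (grad f) (tup_step G eta gam theta 0
    (tup3 (st 0 w), s)))%:E <= (sigma ^+ 2)%:E)%E.
Proof.
have [_ _] := G_noise x0; apply: le_trans.
rewrite le_eqVlt; apply/orP; left; apply/eqP; apply: eq_integral => s _.
(* At k = 0 the conventions gamma = 1 and theta = 1/2 place both evaluation points at [x0] and make
   m^0 a plain sample of the gradient there. *)
rewrite /sqr_err /tup_step tup3K /= !tupK big_ord_recl big_ord1 /=.
rewrite scaler0 add0r big_ord_recl big_ord1 !subrr !mul0r !scale0r !addr0.
by rewrite -scalerDl -[2%:R^-1]mul1r -splitr scale1r.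
Qed.

Let momentum_errorS k w :
  (\int[mu]_s (sqr_err (grad f) (tup_step G eta gam theta k.+1
    (tup3 (st k.+1 w), s)))%:E <=
  ((1 - (rt k)^-1 ^+ 6) * enorm (m k w - grad f (x k w)) ^+ 2 +
    c * (rt k)^-1 ^+ 12)%:E)%E.
Proof.
have [v v1 xS] : exists2 v, enorm v = 1 & x k.+1 w = x k w + eta k *: v.
  exists (- (enorm (m k w))^-1 *: m k w); last exact: alg1_xS.
  have p := enorm_gt0 (m_neq0 k w).
  by rewrite enormZ normrN ger0_norm ?invr_ge0 ?ltW// mulVf// gt_eqF.
(* Extrapolating past x^{k+1} by (1 - g)/g displacements lands at distance eta_k / g from x^k, on
   the same line. *)
have z (g e : R) : g != 0 -> e = eta k * g^-1 ->
    x k.+1 w + ((1 - g) / g) *: (x k.+1 w - x k w) = x k w + e *: v.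
  have xB : x k.+1 w - x k w = eta k *: v by rewrite xS addrAC subrr add0r.
  move=> g0 ->; rewrite xB xS -addrA scalerA -scalerDl.
  by congr (_ + _ *: _); field.
have r0 : rt k != 0 :> R by rewrite gt_eqF// rt_gt0.
set a := theta k ord0; set b := theta k (lift ord0 ord0).
have E s : sqr_err (grad f) (tup_step G eta gam theta k.+1
    (tup3 (st k.+1 w), s)) =
    enorm ((1 - (a + b)) *: m k w +
     (a *: G (x k w + ((rt k)^-1 ^+ 7 * rt k ^+ 6) *: v) s +
      b *: G (x k w + ((rt k)^-1 ^+ 7 * (2 * rt k ^+ 6)) *: v) s) -
     grad f (x k w + (rt k)^-1 ^+ 7 *: v)) ^+ 2.
  rewrite -(z (gam k ord0)); last 2 first.
  - by rewrite gam0 invr_eq0 expf_neq0.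
  - by rewrite gam0 invrK etaE.
  rewrite -(z (gam k (lift ord0 ord0))); last 2 first.
  - by rewrite gam1 invr_eq0 mulf_neq0// expf_neq0.
  - by rewrite gam1 invrK etaE.
  rewrite -etaE -xS /tup_step tup3K /st alg1_stateS /sqr_err /= !tupK.
  by rewrite !big_ord_recl !big_ord0 !addr0.
under eq_integral do rewrite E.
exact: (momentum_error_step f_C3 G_noise L3_gt0 f_L3 (x k w) (m k w)
  (rt_ge1 k) v1 (theta0 k) (theta1 k)).
Qed.

Let momentum_error k :
  (\int[P]_w (enorm (m k w - grad f (x k w)) ^+ 2)%:E <=
   (err_bound sigma c k)%:E)%E.
Proof.
pose F k p := (sqr_err (grad f) (tup_step G eta gam theta k p))%:E.
have mF j : measurable_fun setT (F j).
  apply/measurable_EFinP; apply: measurableT_comp.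
    exact: (measurable_sqr_err G_unb).
  exact: measurable_tup_step.
have F0 j p : (0 <= F j p)%E by rewrite lee_fin sqr_ge0.
have FE j w : (enorm (m j w - grad f (x j w)) ^+ 2)%:E =
    F j (tup3 (st j w), xi j w).
  by rewrite /F -tup3_stateS /sqr_err alg1_stateS /= !tupK.
have key j (g : Omega -> \bar R) : measurable_fun setT g ->
    (forall w, (\int[mu]_s F j (tup3 (st j w), s) <= g w)%E) ->
    (\int[P]_w (enorm (m j w - grad f (x j w)) ^+ 2)%:E <= \int[P]_w g w)%E.
  move=> mg Fg; under eq_integral do rewrite FE.
  apply: (ge0_integral_process_le xi_meas xi_law xi_indep
    (S := fun k w => tup3 (st k w)) (step := tup_step G eta gam theta)
    (s0 := tup3 (x0, x0, 0))) => //.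
  - by move=> i w; exact: tup3_stateS.
  - by move=> i; exact: measurable_tup_step.
have P1 : (P [set: Omega] = 1)%E := probability_setT P.
elim: k => [|k ih].
  apply: le_trans (key 0%N (cst (sigma ^+ 2)%:E) _ momentum_error0) _ => //.
  rewrite integral_cst//.
  by rewrite [X in (_ * X)%E](_ : _ = 1%E) ?mule1; last exact: P1.
have i0 : 0 <= (rt k)^-1 :> R by rewrite invr_ge0 ltW// rt_gt0.
have i1 : 0 <= 1 - (rt k)^-1 ^+ 6 :> R.
  by rewrite subr_ge0 exprn_ile1// invf_le1 ?rt_gt0 ?rt_ge1.
have i12 : 0 <= c * (rt k)^-1 ^+ 12 by rewrite mulr_ge0 ?exprn_ge0.
have mE := measurable_error k.
apply: le_trans (key k.+1 _ _ (momentum_errorS k)) _.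
  apply/measurable_EFinP.
  by apply: measurable_funD => //; exact: measurable_funM.
under eq_integral do rewrite EFinD EFinM.
rewrite ge0_integralD//; last 2 first.
- by move=> w _; rewrite -EFinM lee_fin mulr_ge0 ?sqr_ge0.
- by apply/measurable_EFinP; exact: measurable_funM.
rewrite ge0_integralZl//; last 2 first.
- by apply/measurable_EFinP.
- by move=> w _; rewrite lee_fin sqr_ge0.
rewrite integral_cst// [X in (_ + _ * X <= _)%E](_ : _ = 1%E); last exact: P1.
rewrite mule1 /= [leRHS]EFinD; apply: leeD => //.
by rewrite [leRHS]EFinM; apply: lee_wpmul2l; rewrite ?lee_fin.
Qed.

Let descent_sum K w : \sum_(k < K) eta k * enorm (grad f (x k w)) <=
  f x0 - flow + (5 / 4 + L1 / 2) * \sum_(k < K) (rt k)^-1 ^+ 10 +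
  \sum_(k < K) 4 / 5 * (rt k)^-1 ^+ 4 * enorm (m k w - grad f (x k w)) ^+ 2.
Proof.
suff : \sum_(k < K) eta k * enorm (grad f (x k w)) + f (x K w) <=
  f x0 + (5 / 4 + L1 / 2) * \sum_(k < K) (rt k)^-1 ^+ 10 +
  \sum_(k < K) 4 / 5 * (rt k)^-1 ^+ 4 * enorm (m k w - grad f (x k w)) ^+ 2.
  by have := f_low (x K w); lra.
elim: K => [|K ih]; first by rewrite !big_ord0 mulr0 !addr0 add0r.
rewrite !big_ord_recr/=; have r0 := @rt_gt0 R K; have r1 := @rt_ge1 R K.
have i0 : 0 < (rt K)^-1 :> R by rewrite invr_gt0.
(* This Young parameter makes the error terms match the left side of [error_sum] and turns eta^2 / a
   into (5/4) r^-10. *)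
have i4 : 0 < 4 / 5 * (rt K)^-1 ^+ 4 :> R by rewrite mulr_gt0 ?exprn_gt0//; lra.
have eta0 : 0 <= eta K by rewrite etaE exprn_ge0// ltW.
have step := normalized_descent f_C3 (x K w) (m_neq0 K w) f_L1 eta0 i4.
rewrite -alg1_xS -/x in step.
have rem : eta K ^+ 2 / (4 / 5 * (rt K)^-1 ^+ 4) + L1 * eta K ^+ 2 / 2 <=
    (5 / 4 + L1 / 2) * (rt K)^-1 ^+ 10.
  rewrite etaE (_ : _ / (_ * _) = 5 / 4 * (rt K)^-1 ^+ 10); last first.
    by rewrite !exprVn; field; rewrite gt_eqF.
  rewrite (mulrDl (5 / 4)) lerD2l mulrAC.
  apply: ler_wpM2l; first by rewrite divr_ge0// ltW.
  by rewrite -exprM; apply: ler_wiXn2l => //; [exact: ltW|rewrite invf_le1].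
exact: (descent_arith ih step rem).
Qed.

Lemma weighted_gradient_sum K :
  (\sum_(k < K) (eta k)%:E * \int[P]_w (enorm (grad f (x k w)))%:E <=
   (f x0 - flow + 2 * sigma ^+ 2 +
    (5 / 4 + L1 / 2 + 6 / 5 * c) * \sum_(k < K) (rt k)^-1 ^+ 10)%:E)%E.
Proof.
have i0 k : 0 < (rt k)^-1 :> R by rewrite invr_gt0 rt_gt0.
have eta0 k : 0 <= eta k by rewrite etaE exprn_ge0// ltW.
set C := f x0 - flow + (5 / 4 + L1 / 2) * \sum_(k < K) (rt k)^-1 ^+ 10.
have C0 : 0 <= C.
  apply: addr_ge0; first by rewrite subr_ge0.
  apply: mulr_ge0; first by apply: addr_ge0; rewrite divr_ge0// ltW.
  by apply: sumr_ge0 => k _; rewrite exprn_ge0// ltW.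
pose a k : R := 4 / 5 * (rt k)^-1 ^+ 4.
have a0 k : 0 <= a k.
  by rewrite /a; apply: mulr_ge0; [lra|apply: exprn_ge0; exact: ltW].
pose e k w := enorm (m k w - grad f (x k w)) ^+ 2.
have e0 k w : 0 <= e k w by exact: sqr_ge0.
have P1 : (P [set: Omega] = 1)%E := probability_setT P.
have -> : (\sum_(k < K) (eta k)%:E * \int[P]_w (enorm (grad f (x k w)))%:E =
    \int[P]_w (\sum_(k < K) eta k * enorm (grad f (x k w)))%:E)%E.
  under [RHS]eq_integral do rewrite -sumEFin.
  rewrite ge0_integral_sum//.
  - apply: eq_bigr => k _; rewrite -ge0_integralZl//.
    + by apply/measurable_EFinP; exact: measurable_grad.
    + by move=> w _; rewrite lee_fin enorm_ge0.
    + by rewrite lee_fin.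
  - by move=> k; apply/measurable_EFinP; exact: measurable_funM.
  - by move=> k w _; rewrite lee_fin mulr_ge0// enorm_ge0.
have mae k : measurable_fun setT (fun w => a k * e k w).
  by apply: measurable_funM => //; exact: measurable_error.
apply: (@le_trans _ _ (\int[P]_w (C%:E + \sum_(k < K) (a k * e k w)%:E))%E).
  apply: ge0_le_integral => //.
  - move=> w _; rewrite lee_fin sumr_ge0// => k _.
    by rewrite mulr_ge0// enorm_ge0.
  - apply/measurable_EFinP; apply: measurable_sum => k.
    exact: measurable_funM.
  - apply: emeasurable_funD => //; apply: emeasurable_sum => k.
    exact/measurable_EFinP.
  - by move=> w _; rewrite sumEFin -EFinD lee_fin; exact: descent_sum.
rewrite ge0_integralD//; last 2 first.
- by move=> w _; apply: sume_ge0 => k _; rewrite lee_fin mulr_ge0.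
- by apply: emeasurable_sum => k; exact/measurable_EFinP.
rewrite integral_cst// [X in (_ * X + _ <= _)%E](_ : _ = 1%E); last exact: P1.
rewrite mule1 ge0_integral_sum//; last 2 first.
- by move=> k; exact/measurable_EFinP.
- by move=> k w _; rewrite lee_fin mulr_ge0.
apply: (@le_trans _ _ (C%:E + \sum_(k < K) (a k * err_bound sigma c k)%:E)%E).
  rewrite leeD2lE//; apply: lee_sum => k _.
  under eq_integral do rewrite EFinM.
  rewrite ge0_integralZl ?lee_fin//; last 2 first.
  - by apply/measurable_EFinP; exact: measurable_error.
  - by move=> w _; rewrite lee_fin.
  rewrite [leRHS]EFinM; apply: lee_wpmul2l; rewrite ?lee_fin//.
  exact: momentum_error.
rewrite sumEFin -EFinD lee_fin.
have /= := error_sum c_ge0 (fun k => err_bound_ge0 sigma k c_ge0)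
  (fun k => lexx _) K.
by rewrite -/a /C; lra.
Qed.

End Convergence.

Theorem theorem3p4
  (R : realType) (n : nat)
  (d : measure_display) (Omega : measurableType d) (P : probability Omega R)
  (dX : measure_display) (Xi : measurableType dX) (mu : probability Xi R)
  (f : 'rV[R]_n -> R) (flow L1 L3 sigma : R)
  (G : 'rV[R]_n -> Xi -> 'rV[R]_n) (xi : nat -> Omega -> Xi) (x0 : 'rV[R]_n)
  (* Assumption A *)
  (hflow : forall x, flow <= f x)
  (hL1 : 0 < L1)
  (hgradL : forall x y, enorm (grad f y - grad f x) <= L1 * enorm (y - x))
  (hsigma : 0 < sigma)
  (hGint : forall x (i : 'I_n), mu.-integrable setT (fun s => (G x s ord0 i)%:E))
  (hGunb : forall x (i : 'I_n),
     (\int[mu]_s (G x s ord0 i)%:E = (grad f x ord0 i)%:E)%E)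
  (hGvar : forall x,
     (\int[mu]_s ((enorm (G x s - grad f x)) ^+ 2)%:E <= (sigma ^+ 2)%:E)%E)
  (* G is jointly (Borel) measurable in (x, s) *)
  (hGmeas : forall i : 'I_n,
     measurable_fun setT
       (fun p : n.-tuple R * Xi => G (\row_(j < n) tnth p.1 j) p.2 ord0 i))
  (* Assumption B with p = 3 *)
  (hC3 : C3 f) (hL3 : 0 < L3) (hL3lip : third_deriv_lipschitz f L3)
  (* xi^0, xi^1, ... independent samples of xi (law mu) *)
  (hxi_meas : forall k, measurable_fun setT (xi k))
  (hxi_law : forall k (A : set Xi), measurable A -> P (xi k @^-1` A) = mu A)
  (hxi_indep : mutually_independent P xi) :
  let eta := fun k : nat => ((k + 3)%:R `^ (7 / 10))^-1 in
  let gam := fun (k : nat) (t : 'I_2) =>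
    if val t == 0%N then ((k + 3)%:R `^ (3 / 5))^-1
    else (2 * (k + 3)%:R `^ (3 / 5))^-1 in
  let theta := fun (k : nat) (t : 'I_2) =>
    if val t == 0%N then (2 * (k + 3)%:R `^ (3 / 5) - 1) / (k + 3)%:R `^ (6 / 5)
    else (1 - (k + 3)%:R `^ (3 / 5)) / (2 * (k + 3)%:R `^ (6 / 5)) in
  let x := alg1_x x0 eta gam theta G xi in
  let m := alg1_m x0 eta gam theta G xi in
  (* m^k <> 0 (implicitly assumed by Algorithm 1) *)
  (forall k w, m k w != 0) ->
  let M3 := 4 * (f x0 - flow + 19 * sigma ^+ 2 + L1 + 4 * L3 ^+ 2 + 2) in
  forall eps : R, 0 < eps < 1 ->
  forall K : nat,
    Num.max (((20 * M3 / (3 * eps)) * ln (20 * M3 / (3 * eps))) `^ (10 / 3))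
            5 <= K%:R ->
    (* E[ ||grad f(x^{iota_K})|| ], iota_K uniform on {0,...,K-1} and
       independent of the algorithm *)
    ((K%:R^-1)%:E *
      \sum_(k < K) \int[P]_w (enorm (grad f (x k w)))%:E <= eps%:E)%E.
Proof.
move=> eta gam theta x m m_neq0 M3 eps eps01 K hK.
have etaE k : eta k = (rt k)^-1 ^+ 7.
  by rewrite /eta (@powR_rt _ k 7) ?exprVn.
have p6 k : (k + 3)%:R `^ (3 / 5) = rt k ^+ 6 :> R.
  by apply: powR_rt; field.
have p12 k : (k + 3)%:R `^ (6 / 5) = rt k ^+ 12 :> R.
  by apply: powR_rt; field.
have gam0 k : gam k ord0 = (rt k ^+ 6)^-1 by rewrite /gam /= p6.
have gam1 k : gam k (lift ord0 ord0) = (2 * rt k ^+ 6)^-1 by rewrite /gam /= p6.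
have theta0 k : theta k ord0 = (2 * rt k ^+ 6 - 1) / rt k ^+ 12.
  by rewrite /theta /= p6 p12.
have theta1 k : theta k (lift ord0 ord0) = (1 - rt k ^+ 6) / (2 * rt k ^+ 12).
  by rewrite /theta /= p6 p12.
have G_noise y : noise mu sigma (fun s => G y s - grad f y).
  have E i : (fun s => ((G y s - grad f y) ord0 i)%:E) =
      (fun s => (G y s ord0 i)%:E - (grad f y ord0 i)%:E)%E.
    by apply: funext => s; rewrite !mxE EFinB.
  have ic i : mu.-integrable setT (fun=> (grad f y ord0 i)%:E).
    exact: finite_measure_integrable_cst.
  have mu1 : (mu [set: Xi] = 1)%E := probability_setT mu.
  split => // i; rewrite E; first exact: integrableB.
  rewrite integralB// hGunb integral_cst//.
  by rewrite [X in (_ - _ * X)%E](_ : _ = 1%E) ?mule1 ?subee//; exact: mu1.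
have sum_le :=
  weighted_gradient_sum hflow hL1 hgradL hC3 hL3 hL3lip hGunb
  G_noise hGmeas hxi_meas hxi_law hxi_indep
  etaE gam0 gam1 theta0 theta1 m_neq0 K.
have flow0 := hflow x0.
have M8 : 8 <= M3.
  by rewrite /M3; have := sqr_ge0 sigma; have := sqr_ge0 L3; lra.
have [K5 Keps] := rate_bound M8 eps01 hK.
have K0 : 0 < K%:R :> R by rewrite ltr0n (leq_trans _ K5).
have lnK1 : 1 <= ln (K%:R : R).
  by apply: ln_ge1; rewrite (ler_nat _ 4) ltnW.
have sum_ln : \sum_(k < K) (rt k)^-1 ^+ 10 <= ln (K%:R : R).
  apply: (le_trans _ (@sum_inv_le_ln R K (leq_trans (isT : 2 <= 5)%N K5))).
  by apply: ler_sum => k _; rewrite exprVn rt10.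
pose D : R := 2 * K%:R `^ (7 / 10).
have D0 : 0 <= D by rewrite mulr_ge0 ?powR_ge0.
(* For k < K and K >= 3, k + 3 <= 2K; moreover 2^(7/10) <= 2. *)
have Deta (k : 'I_K) : 1 <= D * eta k.
  have k3 : 0 < (k + 3)%:R :> R by rewrite ltr0n addnS.
  rewrite /D /eta ler_pdivlMr ?powR_gt0// mul1r.
  apply: (@le_trans _ _ ((2 * K%:R) `^ (7 / 10))).
    apply: ge0_ler_powR; [lra|by rewrite nnegrE|by rewrite nnegrE mulr_ge0|].
    rewrite -natrM ler_nat mul2n -addnn.
    exact: leq_add (ltnW (ltn_ord k)) (leq_trans (isT : 3 <= 5)%N K5).
  rewrite powRM// ler_wpM2r ?powR_ge0//; apply: ler1_powR; lra.
apply: (@le_trans _ _ ((K%:R^-1)%:E * (D%:E * \sum_(k < K)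
    ((eta k)%:E * \int[P]_w (enorm (grad f (x k w)))%:E)))%E).
  apply: lee_wpmul2l; first by rewrite lee_fin invr_ge0 ltW.
  rewrite ge0_sume_distrr => [|k _]; last first.
    apply: mule_ge0; first by rewrite lee_fin invr_ge0 powR_ge0.
    by apply: integral_ge0 => w _; rewrite lee_fin enorm_ge0.
  apply: lee_sum => k _; rewrite muleA -EFinM.
  rewrite -[leLHS]mul1e; apply: lee_wpmul2r; last by rewrite lee_fin.
  by apply: integral_ge0 => w _; rewrite lee_fin enorm_ge0.
apply: (@le_trans _ _ ((K%:R^-1)%:E * (D%:E * (M3 / 4 * ln K%:R)%:E))%E).
  apply: lee_wpmul2l; first by rewrite lee_fin invr_ge0 ltW.
  apply: lee_wpmul2l; first by rewrite lee_fin.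
  apply: le_trans sum_le _; rewrite lee_fin.
  have s0 := sqr_ge0 sigma; have l0 := sqr_ge0 L3.
  set S := \sum_(k < K) _ in sum_ln *; set l := ln _ in lnK1 sum_ln *.
  set c := 5 / 4 + L1 / 2 + 6 / 5 * (L3 ^+ 2 + 17 / 2 * sigma ^+ 2).
  have c0 : 0 <= c by rewrite /c; lra.
  have h1 : c * S <= c * l by exact: ler_wpM2l.
  (* ln K >= 1 absorbs the initial terms. Against M3 / 4 the coefficients then satisfy 2 + 51/5 <=
     19 for sigma^2, 6/5 <= 4 for L3^2, 1/2 <= 1 for L1 and 5/4 <= 2. *)
  have h2 : f x0 - flow + 2 * sigma ^+ 2 <= (f x0 - flow + 2 * sigma ^+ 2) * l.
    by rewrite ler_peMr//; lra.
  have h3 : (f x0 - flow + 2 * sigma ^+ 2 + c) * l <= M3 / 4 * l.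
    by apply: ler_wpM2r; [lra|rewrite /c /M3; lra].
  by lra.
by rewrite -!EFinM lee_fin.
Qed.
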